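(* Let $G$ be a duality group with cohomological dimension $\mathrm{cd}(G) \neq 1$, let $X$ be a compact space, and suppose that $G \curvearrowright X$ is a topological dynamical system which is almost $\mathbb{Z}G$-projective. Then $G \curvearrowright X$ is continuous $H$-cocycle rigid for every solvable group $H$.
   Context: All groups are discrete and countable; all topological spaces are locally compact and Hausdorff. A topological dynamical system $G \curvearrowright X$ is an action $(g,x) \mapsto g.x$ of a group $G$ on a space $X$ by homeomorphisms. A group $G$ is called a duality group (as in Brown's book ''Cohomology of groups'') if $G$ is of type FP (i.e., the trivial module $\mathbb{Z}$ has a finite-length resolution by finitely generated projective $\mathbb{Z}G$-modules) and there is an integer $n$ such that $H^i(G,\mathbb{Z}G) = 0$ for all $i \neq n$ and $H^n(G,\mathbb{Z}G)$ is torsion-free as an abelian group (then $n = \mathrm{cd}(G)$). A system $G \curvearrowright X$ with $X$ compact is almost $\mathbb{Z}G$-projective if $C(X,\mathbb{Z}) \cong \mathbb{Z} \oplus P$ as $\mathbb{Z}G$-modules, where the copy of $\mathbb{Z}$ is given by the constant functions on $X$ and $P$ is a projective $\mathbb{Z}G$-module. Here $G$ acts on $C(X,\mathbb{Z})$ by $(g.f)(x) = f(g^{-1}.x)$. A continuous $H$-cocycle for $G \curvearrowright X$ is a continuous map $a: G \times X \to H$ ($G$, $H$ discrete) with $a(g_1g_2,x) = a(g_1,g_2.x)a(g_2,x)$ for all $g_1,g_2 \in G$, $x \in X$. Two such cocycles $a,a'$ are continuously cohomologous if there is a continuous map $u: X \to H$ with $a(g,x) = u(g.x)a'(g,x)u(x)^{-1}$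 for all $g,x$. $G \curvearrowright X$ is continuous $H$-cocycle rigid if every continuous $H$-cocycle for $G \curvearrowright X$ is continuously cohomologous to a group homomorphism $\rho: G \to H$, viewed as the cocycle $(g,x) \mapsto \rho(g)$. *)

(* Defs.v *)
From HB Require Import structures.
From mathcomp Require Import all_boot all_order all_algebra finmap.
From mathcomp Require Import monalg.
From mathcomp Require Import boolp classical_sets functions cardinality.
From mathcomp Require Import topology.

Set Implicit Arguments.
Unset Strict Implicit.
Unset Printing Implicit Defensive.

Import GRing.Theory.

Local Open Scope classical_set_scope.
Local Open Scope ring_scope.

(* [{malg int[G]}] is the additive group of finitely supported functions
   [G -> int]. The product of multinomials' [malg] is only defined over a
   [monomType], which has no nontrivial units, so the convolution product is
   defined here, on an alias. *)
Definition zgring (G : groupType) : Type := {malg int[G]}.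

HB.instance Definition _ (G : groupType) :=
  GRing.Zmodule.copy (zgring G) {malg int[G]}.

Section AdditiveExtension.
Variables (K : choiceType) (V : zmodType) (f : K -> V).

Definition malg_ext (a : {malg int[K]}) : V :=
  \sum_(k <- msupp a) f k *~ a@_k.

Lemma malg_extEw (d : {fset K}) (a : {malg int[K]}) :
  (msupp a `<=` d)%fset -> malg_ext a = \sum_(k <- d) f k *~ a@_k.
Proof.
move=> le_ad; rewrite /malg_ext (big_fset_incl _ le_ad) //= => k _.
by move=> /mcoeff_outdom ->; rewrite mulr0z.
Qed.

Lemma malg_ext0 : malg_ext 0 = 0.
Proof. by rewrite /malg_ext msupp0 big_seq_fset0. Qed.

Lemma malg_extD : {morph malg_ext : a b / a + b}.
Proof.
move=> a b.
rewrite (malg_extEw (fsubsetUl (msupp a) (msupp b))).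
rewrite (malg_extEw (fsubsetUr (msupp a) (msupp b))).
rewrite (malg_extEw (msuppD_le a b)) -big_split /=.
by apply: eq_bigr => k _; rewrite mcoeffD mulrzDr.
Qed.

Lemma malg_ext_sum (I : Type) (r : seq I) (F : I -> {malg int[K]}) :
  malg_ext (\sum_(i <- r) F i) = \sum_(i <- r) malg_ext (F i).
Proof. exact: (big_morph _ malg_extD malg_ext0). Qed.

Lemma malg_extU (z : int) (k : K) : malg_ext << z *g k >> = f k *~ z.
Proof.
by rewrite (malg_extEw (@msuppU_le _ _ k z)) big_seq_fset1 mcoeffUU.
Qed.

End AdditiveExtension.

Lemma malgUMz (K : choiceType) (z t : int) (k : K) :
  << z *g k >> *~ t = << z * t *g k >> :> {malg int[K]}.
Proof. by rewrite -mulrzz raddfMz. Qed.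

Section GroupRing.
Variable G : groupType.
Implicit Types a b c : {malg int[G]}.

Definition zgring_one : {malg int[G]} := << 1 *g 1%g >>.

Definition zgring_mul a b : {malg int[G]} :=
  \sum_(g <- msupp a) \sum_(h <- msupp b) << a@_g * b@_h *g (g * h)%g >>.

Lemma zgring_mulE a b :
  zgring_mul a b
  = malg_ext (fun g => malg_ext (fun h => << 1 *g (g * h)%g >>) b) a.
Proof.
apply: eq_bigr => g _; rewrite /malg_ext mulrz_suml; apply: eq_bigr => h _.
by rewrite -mulrzA malgUMz mul1r mulrC.
Qed.

Lemma zgring_mulDl : left_distributive zgring_mul +%R.
Proof. by move=> a b c; rewrite !zgring_mulE malg_extD. Qed.

Lemma zgring_mul0r : left_zero 0 zgring_mul.
Proof. by move=> a; rewrite zgring_mulE malg_ext0. Qed.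

Lemma zgring_mulDr : right_distributive zgring_mul +%R.
Proof.
move=> a b c; rewrite !zgring_mulE /malg_ext -big_split /=.
by apply: eq_bigr => g _; rewrite -mulrzDl -malg_extD.
Qed.

Lemma zgring_mulr0 : right_zero 0 zgring_mul.
Proof.
move=> a; rewrite zgring_mulE /malg_ext big1 // => g _.
by rewrite msupp0 big_seq_fset0 mul0rz.
Qed.

Lemma zgring_mulUU (z t : int) (g h : G) :
  zgring_mul << z *g g >> << t *g h >> = << z * t *g (g * h)%g >>.
Proof.
by rewrite zgring_mulE !malg_extU -mulrzA malgUMz mul1r mulrC.
Qed.

Lemma zgring_mulsl (I : Type) (r : seq I) (F : I -> {malg int[G]}) b :
  zgring_mul (\sum_(i <- r) F i) b = \sum_(i <- r) zgring_mul (F i) b.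
Proof.
exact: (big_morph (zgring_mul^~ b) (fun _ _ => zgring_mulDl _ _ _)
          (zgring_mul0r _)).
Qed.

Lemma zgring_mulsr (I : Type) (r : seq I) (F : I -> {malg int[G]}) a :
  zgring_mul a (\sum_(i <- r) F i) = \sum_(i <- r) zgring_mul a (F i).
Proof.
exact: (big_morph (zgring_mul a) (fun _ _ => zgring_mulDr _ _ _)
          (zgring_mulr0 _)).
Qed.

Lemma zgring_mulA : associative zgring_mul.
Proof.
move=> a b c; rewrite (monalgE a) !zgring_mulsl; apply: eq_bigr => g _.
rewrite (monalgE b) !(zgring_mulsl, zgring_mulsr); apply: eq_bigr => h _.
rewrite (monalgE c) !zgring_mulsr; apply: eq_bigr => k _.
by rewrite !zgring_mulUU mulrA mulgA.
Qed.

Lemma zgring_mul1r : left_id zgring_one zgring_mul.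
Proof.
move=> a; rewrite [in LHS](monalgE a) [RHS]monalgE zgring_mulsr.
by apply: eq_bigr => g _; rewrite zgring_mulUU mul1r mul1g.
Qed.

Lemma zgring_mulr1 : right_id zgring_one zgring_mul.
Proof.
move=> a; rewrite [in LHS](monalgE a) [RHS]monalgE zgring_mulsl.
by apply: eq_bigr => g _; rewrite zgring_mulUU mulr1 mulg1.
Qed.

Lemma zgring_one_neq0 : zgring_one != 0.
Proof. by rewrite monalgU_eq0. Qed.

HB.instance Definition _ := GRing.Zmodule_isNzRing.Build (zgring G)
  zgring_mulA zgring_mul1r zgring_mulr1 zgring_mulDl zgring_mulDr
  zgring_one_neq0.

End GroupRing.

Record gaction (G : groupType) (M : zmodType) := GAction {
  gact :> G -> M -> M;
  gactD : forall g, {morph gact g : u v / u + v};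
  gact1 : forall u, gact 1%g u = u;
  gactM : forall g h u, gact (g * h)%g u = gact g (gact h u) }.

(* The ZG-module with underlying abelian group [M] and [G] acting by [r]. *)
Definition gmodule (G : groupType) (M : zmodType) (r : gaction G M) : Type := M.

Section GModule.
Variables (G : groupType) (M : zmodType) (r : gaction G M).

HB.instance Definition _ := GRing.Zmodule.copy (gmodule r) M.

Definition gmodule_scale (a : zgring G) (u : gmodule r) : gmodule r :=
  \sum_(g <- msupp a) r g u *~ a@_g.

Lemma gmodule_scaleE a u : gmodule_scale a u = malg_ext (r^~ u) a.
Proof. by []. Qed.

Lemma gact_sum (g : G) (I : Type) (s : seq I) (F : I -> M) :
  r g (\sum_(i <- s) F i) = \sum_(i <- s) r g (F i).
Proof.
apply: (big_morph _ (gactD r g)); apply: (addrI (r g 0)).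
by rewrite -gactD !addr0.
Qed.

Lemma gactMz (g : G) (u : M) (z : int) : r g (u *~ z) = r g u *~ z.
Proof.
have r0 : r g 0 = 0 by apply: (addrI (r g 0)); rewrite -gactD !addr0.
have rN v : r g (- v) = - r g v.
  by apply: (addrI (r g v)); rewrite -gactD !subrr.
have rn n : r g (u *+ n) = r g u *+ n.
  by elim: n => [|n IHn]; rewrite ?mulr0n // !mulrS gactD IHn.
by case: z => n; rewrite ?NegzE ?mulrNz ?rN -!pmulrn rn.
Qed.

Lemma gmodule_scaleA a b u :
  gmodule_scale a (gmodule_scale b u) = gmodule_scale (a * b) u.
Proof.
rewrite !gmodule_scaleE [a * b]zgring_mulE malg_ext_sum.
apply: eq_bigr => g _; rewrite -[RHS]gmodule_scaleE.
have scaleMz c z : gmodule_scale (c *~ z) u = gmodule_scale c u *~ z.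
  have sD : {morph (gmodule_scale^~ u) : x y / x + y}.
    by move=> x y; rewrite !gmodule_scaleE malg_extD.
  have s0 : gmodule_scale 0 u = 0 by rewrite gmodule_scaleE malg_ext0.
  have sN v : gmodule_scale (- v) u = - gmodule_scale v u.
    by apply: (addrI (gmodule_scale v u)); rewrite -sD !subrr.
  have sn n : gmodule_scale (c *+ n) u = gmodule_scale c u *+ n.
    by elim: n => [|n IHn]; rewrite ?mulr0n // !mulrS sD IHn.
  by case: z => n; rewrite ?NegzE ?mulrNz ?sN -!pmulrn sn.
rewrite scaleMz; congr (_ *~ _).
rewrite gact_sum gmodule_scaleE malg_ext_sum; apply: eq_bigr => h _.
rewrite gactMz -gmodule_scaleE scaleMz; congr (_ *~ _).
by rewrite gmodule_scaleE malg_extU mulr1z gactM.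
Qed.

Lemma gmodule_scale1 : left_id 1 gmodule_scale.
Proof. by move=> u; rewrite gmodule_scaleE malg_extU mulr1z gact1. Qed.

Lemma gmodule_scaleDr : right_distributive gmodule_scale +%R.
Proof.
move=> a u v; rewrite /gmodule_scale -big_split /=.
by apply: eq_bigr => g _; rewrite gactD mulrzDl.
Qed.

Lemma gmodule_scaleDl u : {morph gmodule_scale^~ u : a b / a + b}.
Proof. by move=> a b; rewrite !gmodule_scaleE malg_extD. Qed.

HB.instance Definition _ := GRing.Zmodule_isLmodule.Build (zgring G) (gmodule r)
  gmodule_scaleA gmodule_scale1 gmodule_scaleDr gmodule_scaleDl.

End GModule.

Definition trivial_gaction (G : groupType) (M : zmodType) : gaction G M :=
  @GAction G M (fun _ u => u) (fun _ _ _ => erefl) (fun _ => erefl)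
    (fun _ _ _ => erefl).

Definition trivZ (G : groupType) : lmodType (zgring G) :=
  gmodule (trivial_gaction G int).

Definition regular_module (G : groupType) : lmodType (zgring G) := (zgring G)^o.

Definition projective_module (R : nzRingType) (P : lmodType R) : Prop :=
  forall (M N : lmodType R) (p : {linear M -> N}) (f : {linear P -> N}),
    (forall y, exists x, p x = y) ->
    exists g : {linear P -> M}, forall x, p (g x) = f x.

Definition finitely_generated (R : nzRingType) (M : lmodType R) : Prop :=
  exists (n : nat) (e : 'I_n -> M),
    forall x, exists c : 'I_n -> R, x = \sum_i c i *: e i.

Record projective_resolution (G : groupType) := ProjectiveResolution {
  res_mod :> nat -> lmodType (zgring G);
  res_d : forall i, {linear res_mod i.+1 -> res_mod i};
  res_aug : {linear res_mod 0%N -> trivZ G};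
  res_projective : forall i, projective_module (res_mod i);
  res_aug_surj : forall k, exists x, res_aug x = k;
  res_exact0 : forall x, res_aug x = 0 <-> exists y, res_d 0 y = x;
  res_exact : forall i x, res_d i x = 0 <-> exists y, res_d i.+1 y = x }.

Definition resolution_length_le (G : groupType)
    (F : projective_resolution G) (n : nat) : Prop :=
  forall i, (n < i)%N -> forall x : F i, x = 0.

Definition has_cd (G : groupType) (n : nat) : Prop :=
  (exists F : projective_resolution G, resolution_length_le F n) /\
  forall (m : nat) (F : projective_resolution G),
    resolution_length_le F m -> (n <= m)%N.

Section Cohomology.
Variables (G : groupType) (F : projective_resolution G).
Variable M : lmodType (zgring G).

Definition cocycle (i : nat) (f : F i -> M) : Prop :=
  forall y, f (res_d F i y) = 0.

Definition coboundary (i : nat) : (F i -> M) -> Prop :=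
  match i with
  | 0%N => fun f => forall x, f x = 0
  | j.+1 => fun f => exists h : {linear F j -> M},
                       forall x, f x = h (res_d F j x)
  end.

(* H^i(G, M) = H^i(Hom_ZG(F, M)) is independent of the resolution [F]. *)
Definition cohomology_zero (i : nat) : Prop :=
  forall f : {linear F i -> M}, cocycle f -> coboundary f.

Definition cohomology_torsion_free (i : nat) : Prop :=
  forall (f : {linear F i -> M}) (k : nat), cocycle f -> (0 < k)%N ->
    coboundary (fun x => f x *+ k) -> coboundary f.

End Cohomology.

Definition finite_type (G : groupType) (F : projective_resolution G) : Prop :=
  (exists n, resolution_length_le F n) /\ forall i, finitely_generated (F i).

(* [finite_type F] says that [G] is of type FP; the cohomology with coefficients
   in ZG is then computed from [F] itself. *)
Definition duality_group (G : groupType) : Prop :=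
  exists F : projective_resolution G, finite_type F /\
  exists n : nat,
    (forall i, i != n -> cohomology_zero F (regular_module G) i) /\
    cohomology_torsion_free F (regular_module G) n.

Record dynamical_system (G : groupType) (X : topologicalType) :=
  DynamicalSystem {
  dact :> G -> X -> X;
  dact1 : forall x, dact 1%g x = x;
  dactM : forall g h x, dact (g * h)%g x = dact g (dact h x);
  dact_continuous : forall g, continuous (dact g) }.

Definition CXZ (X : topologicalType) : Type :=
  continuousType X (discrete_topology int).

Section CXZ.
Variable X : topologicalType.

HB.instance Definition _ := Choice.on (CXZ X).

Lemma discrete_continuousP (T : choiceType)
    (f : X -> discrete_topology T) :
  continuous f <-> forall x, \forall y \near x, f y = f x.
Proof.
split=> [fc x|fl x]; first exact: (fc x _ (discrete_set1 (f x))).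
exact: near_cst_continuous (fl x).
Qed.

Lemma CXZ_near (f : CXZ X) (x : X) : \forall y \near x, f y = f x.
Proof. by move: x; apply: (discrete_continuousP f).1; exact: cts_fun. Qed.

Lemma CXZ_opp_continuous (f : CXZ X) :
  continuous ((fun x => - (f x : int)) : X -> discrete_topology int).
Proof.
apply/discrete_continuousP => x.
by apply: filterS (CXZ_near f x) => y /= ->.
Qed.

Lemma CXZ_add_continuous (f g : CXZ X) :
  continuous ((fun x => (f x : int) + (g x : int))
              : X -> discrete_topology int).
Proof.
apply/discrete_continuousP => x.
by apply: filterS2 (CXZ_near f x) (CXZ_near g x) => y -> ->.
Qed.

Definition CXZ_zero : CXZ X := cst (0 : int).
Definition CXZ_opp (f : CXZ X) : CXZ X := mkcts (@CXZ_opp_continuous f).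
Definition CXZ_add (f g : CXZ X) : CXZ X := mkcts (@CXZ_add_continuous f g).

Lemma CXZ_addA : associative CXZ_add.
Proof. by move=> f g h; apply/continuousEP => x; rewrite /= /mkcts addrA. Qed.

Lemma CXZ_addC : commutative CXZ_add.
Proof. by move=> f g; apply/continuousEP => x; rewrite /= /mkcts addrC. Qed.

Lemma CXZ_add0 : left_id CXZ_zero CXZ_add.
Proof. by move=> f; apply/continuousEP => x; rewrite /= /mkcts add0r. Qed.

Lemma CXZ_addN : left_inverse CXZ_zero CXZ_opp CXZ_add.
Proof. by move=> f; apply/continuousEP => x; rewrite /= /mkcts addNr. Qed.

HB.instance Definition _ := GRing.isZmodule.Build (CXZ X)
  CXZ_addA CXZ_addC CXZ_add0 CXZ_addN.

Variables (G : groupType) (act : dynamical_system G X).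

Lemma CXZ_act_continuous (g : G) (f : CXZ X) :
  continuous ((fun x => f (act g^-1%g x)) : X -> discrete_topology int).
Proof.
move=> x; apply: (@continuous_comp _ _ _ (act g^-1%g) f).
  exact: dact_continuous.
exact: cts_fun.
Qed.

Definition CXZ_act (g : G) (f : CXZ X) : CXZ X :=
  mkcts (@CXZ_act_continuous g f).

Lemma CXZ_actD g : {morph CXZ_act g : f h / f + h}.
Proof. by move=> f h; apply/continuousEP. Qed.

Lemma CXZ_act1 f : CXZ_act 1%g f = f.
Proof. by apply/continuousEP => x; rewrite /= /mkcts invg1 dact1. Qed.

Lemma CXZ_actM g h f : CXZ_act (g * h)%g f = CXZ_act g (CXZ_act h f).
Proof. by apply/continuousEP => x; rewrite /= /mkcts invgM dactM. Qed.

Definition CXZ_gaction : gaction G (CXZ X) :=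
  GAction CXZ_actD CXZ_act1 CXZ_actM.

Definition CXZ_module : lmodType (zgring G) := gmodule CXZ_gaction.

End CXZ.

Definition almost_ZG_projective (G : groupType) (X : topologicalType)
    (act : dynamical_system G X) : Prop :=
  exists P : lmodType (zgring G), projective_module P /\
  exists phi : {linear (trivZ G * P)%type -> CXZ_module act},
    bijective phi /\
    forall (k : int) (x : X), (phi (k, 0) : CXZ X) x = k.

Section CocycleRigidity.
Variables (G H : groupType) (X : topologicalType) (act : dynamical_system G X).

Definition continuous_cocycle (a : G * X -> H) : Prop :=
  continuous (a : discrete_topology G * X -> discrete_topology H) /\
  forall g1 g2 x, a ((g1 * g2)%g, x) = (a (g1, act g2 x) * a (g2, x))%g.

Definition continuously_cohomologous (a a' : G * X -> H) : Prop :=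
  exists u : X -> H, continuous (u : X -> discrete_topology H) /\
  forall g x, a (g, x) = (u (act g x) * a' (g, x) * (u x)^-1)%g.

Definition continuous_cocycle_rigid : Prop :=
  forall a : G * X -> H, continuous_cocycle a ->
  exists rho : {multiplicative G -> H},
    continuously_cohomologous a (fun p => rho p.1).

End CocycleRigidity.

(* [solvable] of the library is about finite groups only. *)
Section Solvable.
Variable H : groupType.

Definition is_subgroup (A : set H) : Prop :=
  A 1%g /\ forall x y, A x -> A y -> A (x * y^-1)%g.

Fixpoint derived_series (n : nat) : set H :=
  match n with
  | 0%N => setT
  | m.+1 => smallest is_subgroup
      [set z | exists x y, [/\ derived_series m x, derived_series m y
                             & z = [~ x, y]%g]]
  end.

Definition solvable_group : Prop := exists n, derived_series n = [set 1%g].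

End Solvable.

(* Main.v *)
From HB Require Import structures.
Require Import Defs.
From mathcomp Require Import all_boot all_order all_algebra finmap.
From mathcomp Require Import monalg.
From mathcomp Require Import boolp classical_sets functions cardinality.
From mathcomp Require Import topology.

(* The projection of [C(X, Z) = Z + P] onto [Z] averages a cocycle with values
   in an abelian section [N = D_k / D_(k+1)] of the derived series of [H] to a
   map [G -> N], and what is left is a 1-cocycle of [G] in the tensor product
   of [P] and [N] with diagonal action. Averaging even applies to a cochain
   whose coboundary is constant on [X], so that [H] need not split over [N].
   As [P] is a direct summand of a free module, the second part embeds in the
   tensor product of a free module with [N], which is induced from the trivial
   group, so that its first cohomology vanishes by universal coefficients: the
   cohomology of [ZG] is zero in degree 1 and torsion-free in degree 2.
   If the dualizing degree is 1 the former is not given, but then a finite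
   resolution can be cut down to length 1; so [cd G <> 1] forces [cd G = 0],
   the augmentation splits, and the cohomology of degree 1 vanishes. *)

Set Implicit Arguments.
Unset Strict Implicit.
Unset Printing Implicit Defensive.

Import GRing.Theory.

Local Open Scope classical_set_scope.
Local Open Scope ring_scope.

(** * Linear algebra and resolutions *)

Section Linear.
Variable R : nzRingType.

Lemma linear_exists (U V : lmodType R) (f : U -> V) :
  linear f -> exists h : {linear U -> V}, h =1 f.
Proof.
move=> fl; pose m := GRing.isLinear.Build R U V _ f fl.
by exists (HB.pack_for {linear U -> V} f m).
Qed.

(** Two preimages under [d] differ by an element of its kernel, which [f] kills, so choosing them
    gives a linear map. With [e] the identity it descends [f] along a surjective [d]; with [f] the
    identity it lifts [e] through an injective [d]. *)
Lemma linear_factor (U V V' M : lmodType R) (d : {linear U -> V})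
    (f : {linear U -> M}) (e : {linear V' -> V}) :
    (forall x, d x = 0 -> f x = 0) -> (forall x, exists y, d y = e x) ->
  exists h : {linear V' -> M}, forall x y, d y = e x -> h x = f y.
Proof.
move=> kerdf /choice[c dc].
have fc x y : d y = e x -> f (c x) = f y.
  move=> dy; apply/eqP; rewrite -subr_eq0 -linearB; apply/eqP/kerdf.
  by rewrite linearB /= dc dy subrr.
have fcl : linear (f \o c).
  by move=> a u v /=; rewrite -linearP; apply: fc; rewrite !linearP !dc.
by have [h hE] := linear_exists fcl; exists h => x y /fc; rewrite hE.
Qed.

Lemma linear_comb_exists (U V : lmodType R) (n : nat)
    (f : 'I_n -> {linear U -> R^o}) (v : 'I_n -> V) :
  exists h : {linear U -> V}, forall x, h x = \sum_i (f i x : R) *: v i.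
Proof.
apply: linear_exists => a x y; rewrite scaler_sumr -big_split /=.
by apply: eq_bigr => i _; rewrite linearP scalerDl scalerA.
Qed.

Lemma dual_basis (P : lmodType R) :
    projective_module P -> finitely_generated P ->
  exists n (e : 'I_n -> P) (e' : 'I_n -> {linear P -> R^o}),
    forall x, x = \sum_i (e' i x : R) *: e i.
Proof.
move=> projP [n [e genP]].
have [p pE] : exists p : {linear 'rV[R]_n -> P},
    forall v, p v = \sum_i v 0 i *: e i.
  apply: linear_exists => a u v; rewrite scaler_sumr -big_split /=.
  by apply: eq_bigr => i _; rewrite !mxE scalerDl scalerA.
have [|g gK] := projP _ _ p idfun.
  move=> y; have [c ->] := genP y; exists (\row_i c i).
  by rewrite pE; apply: eq_bigr => i _; rewrite mxE.
have e'_ex i : exists h : {linear P -> R^o}, forall x, h x = g x 0 i.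
  by apply: linear_exists => a u v; rewrite linearP !mxE.
have [e' e'E] := choice e'_ex.
exists n, e, e' => x; rewrite -[LHS]gK pE.
by apply: eq_bigr => i _; rewrite e'E.
Qed.

End Linear.

(** * Splitting a finite resolution by vanishing cohomology *)

Section Duality.
Variables (G : groupType) (F : projective_resolution G).

Lemma res_d0 i x : res_d F i (res_d F i.+1 x) = 0.
Proof. by apply/res_exact; exists x. Qed.

Lemma res_aug0 x : res_aug F (res_d F 0 x) = 0.
Proof. by apply/res_exact0; exists x. Qed.

(** The coordinates of a cocycle in a dual basis of [Q] are cocycles with values in ZG; their
    primitives recombine along the basis. *)
Lemma cohomology_zero_fg (i : nat) (Q : lmodType (zgring G)) :
    projective_module Q -> finitely_generated Q ->
    cohomology_zero F (regular_module G) i.+1 ->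
  cohomology_zero F Q i.+1.
Proof.
move=> projQ fgQ H0 f cf.
have [n [e [e' eK]]] := dual_basis projQ fgQ.
have ext t : exists h : {linear F i -> regular_module G},
    forall x, e' t (f x) = h (res_d F i x).
  have [|h hE] := H0 (e' t \o f)%FUN; last by exists h => x; rewrite -hE.
  by move=> y /=; rewrite cf linear0.
have [h hE] := choice ext.
have [k kE] := linear_comb_exists h e; exists k => x.
by rewrite [LHS]eK kE; apply: eq_bigr => t _; rewrite hE.
Qed.

(* The vanishing of the cohomology above degree [k] splits the resolution
   there, by descending induction from its length. *)
Lemma resolution_retraction (k : nat) : finite_type F ->
    (forall i, (k < i)%N -> cohomology_zero F (regular_module G) i) ->
  forall i, (k <= i)%N -> exists r : {linear F i -> F i.+1},
    forall x, res_d F i (r (res_d F i x)) = res_d F i x.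
Proof.
move=> [[L FL] fgF] H0.
suff main m i : (k <= i)%N -> (L <= i + m)%N ->
    exists r : {linear F i -> F i.+1},
      forall x, res_d F i (r (res_d F i x)) = res_d F i x.
  by move=> i ki; apply: (main L) => //; exact: leq_addl.
elim: m i => [|m IHm] i ki Li.
  exists (\0)%FUN => x; rewrite addn0 in Li.
  by rewrite (FL i.+1 _ x) // !linear0.
have [||r rK] := IHm i.+1; first exact: leqW.
  by rewrite addSnnS.
(* With [r] splitting the next differential, [id - d r] is a cocycle with values in [F i.+1].
   Writing it as [s d] and applying [d] once more gives [d s d = d]. *)
have [|h hE] := @linear_exists _ (F i.+1) (F i.+1)
    (fun x => x - res_d F i.+1 (r x)).
  by move=> a x y; rewrite !linearP /= scalerDr addrACA.
have [|||s sE] := @cohomology_zero_fg i (F i.+1) _ _ (H0 i.+1 ki) h.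
- exact: res_projective.
- exact: fgF.
- by move=> y; rewrite hE rK subrr.
by exists s => x; rewrite -sE hE linearB /= res_d0 subr0.
Qed.

End Duality.

(** * Dimension at most one *)

Section KernelModule.
Variables (R : nzRingType) (U V : lmodType R) (f : {linear U -> V}).

Definition lkernel : {pred U} := fun x => f x == 0.

Fact lkernel_submod_closed : submod_closed lkernel.
Proof.
split=> [|a x y]; rewrite !unfold_in ?linear0 // => /eqP fx /eqP fy.
by rewrite linearP fx fy scaler0 addr0.
Qed.

HB.instance Definition _ :=
  GRing.isSubmodClosed.Build R U lkernel lkernel_submod_closed.

Record kernel_module :=
  KernelModule { kernel_val : U; _ : kernel_val \in lkernel }.

HB.instance Definition _ := [isSub for kernel_val].
HB.instance Definition _ := [Choice of kernel_module by <:].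
HB.instance Definition _ := [SubChoice_isSubLmodule of kernel_module by <:].

Definition kernel_incl : {linear kernel_module -> U} := val.

Lemma kernel_inclP x : f (kernel_incl x) = 0.
Proof. exact/eqP/(valP x). Qed.

Lemma kernel_incl_inj : injective kernel_incl.
Proof. exact: val_inj. Qed.

Lemma kernel_incl_onto y : f y = 0 -> exists x, kernel_incl x = y.
Proof. by move=> /eqP fy; exists (KernelModule fy). Qed.

End KernelModule.

Section ShortResolution.
Variables (G : groupType) (F : projective_resolution G).
Let K := kernel_module (res_aug F).
Hypothesis projK : projective_module K.
Let zero_module : lmodType (zgring G) := 'rV[zgring G]_0.

Definition short_mod (i : nat) : lmodType (zgring G) :=
  match i with 0%N => F 0%N | 1%N => K | _ => zero_module end.

Definition short_d (i : nat) : {linear short_mod i.+1 -> short_mod i} :=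
  match i return {linear short_mod i.+1 -> short_mod i} with
  | 0%N => kernel_incl (res_aug F)
  | 1%N => (\0)%FUN
  | _ => (\0)%FUN
  end.

(** Once the kernel [K] of the augmentation is projective, [0 -> K -> F 0 -> Z -> 0] is already a
    resolution. *)
Lemma short_resolution : exists F' : projective_resolution G,
  resolution_length_le F' 1.
Proof.
have zero_eq (x y : zero_module) : x = y by apply/rowP => -[].
have projS i : projective_module (short_mod i).
  case: i => [|[|i]] //=; first exact: res_projective.
  move=> M N p f _; exists (\0)%FUN => x.
  by rewrite (zero_eq x 0) !linear0.
unshelve eexists (@ProjectiveResolution G short_mod short_d (res_aug F) projS
  (@res_aug_surj _ F) _ _).
- move=> x; split=> [|[y <-]]; last exact: kernel_inclP.
  exact: kernel_incl_onto.
- case=> [|i] /= x; last first.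
    by rewrite (zero_eq x 0) linear0; split=> // _; exists 0.
  split=> [x0|[y <-]]; last exact: (linear0 (kernel_incl (res_aug F))).
  exists 0; apply: (@kernel_incl_inj _ _ _ (res_aug F)).
  by rewrite linear0.
- by case=> [|[|i]] // _ x; exact: (zero_eq _ _).
Qed.

End ShortResolution.

Lemma length0_projective_trivZ (G : groupType) (F : projective_resolution G) :
  resolution_length_le F 0 -> projective_module (trivZ G).
Proof.
move=> F0 M N p f psurj.
have augI x : res_aug F x = 0 -> x = 0.
  by move=> /res_exact0[y <-]; rewrite (F0 1%N _ y) ?linear0.
have [//|s sK] := @linear_factor _ _ _ _ (F 0%N) (res_aug F) idfun idfun augI.
  exact: res_aug_surj.
have sauK k : res_aug F (s k) = k.
  by have [x xk] := res_aug_surj F k; rewrite (sK k x).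
have [g gE] := @res_projective _ F _ _ _ p (f \o res_aug F)%FUN psurj.
by exists (g \o s)%FUN => k /=; rewrite gE /= sauK.
Qed.

Lemma cohomology1_zero_of_projective_trivZ (G : groupType)
    (F : projective_resolution G) (M : lmodType (zgring G)) :
  projective_module (trivZ G) -> cohomology_zero F M 1.
Proof.
move=> projZ f cf.
have [s sK] := projZ _ _ (res_aug F) idfun (@res_aug_surj _ F).
(* [e] projects [F 0] onto the kernel of the augmentation, which is the image of [d]. The cocycle
   descends to this image, and composing with [e] extends it to [F 0]. *)
have [e eE] : exists e : {linear F 0%N -> F 0%N},
    forall x, e x = x - s (res_aug F x).
  by apply: linear_exists => a x y; rewrite !linearP /= scalerDr addrACA.
have [y /res_exact[z <-]|x|h hE] := @linear_factor _ _ _ _ M (res_d F 0%N) f e.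
- exact: cf.
- by apply/res_exact0; rewrite eE linearB /= sK subrr.
exists h => x; rewrite (hE _ x) // eE res_aug0.
by rewrite linear0 subr0.
Qed.

(** The vanishing splits the image of [F 2] off [F 1]; the quotient, which is the kernel of the
    augmentation by exactness, is then a retract of [F 1]. *)
Lemma projective_kernel_aug (G : groupType) (F : projective_resolution G) :
    finite_type F ->
    (forall i, (1 < i)%N -> cohomology_zero F (regular_module G) i) ->
  projective_module (kernel_module (res_aug F)).
Proof.
move=> ftF H0 M N p f psurj.
have [r rK] := resolution_retraction ftF H0 (leqnn 1).
have [d dE] : exists d : {linear F 1%N -> kernel_module (res_aug F)},
    forall x, kernel_incl _ (d x) = res_d F 0 x.
  have [x /=|x|d dE] := @linear_factor _ _ _ _ _ (kernel_incl (res_aug F))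
    idfun (res_d F 0%N).
  - by rewrite -(linear0 (kernel_incl (res_aug F))); apply: kernel_incl_inj.
  - by apply: kernel_incl_onto; rewrite res_aug0.
  have {}dE x y := dE x y; exists d => x.
  have [y yE] := kernel_incl_onto (res_aug0 x).
  by rewrite (dE _ _ yE).
have [e eE] : exists e : {linear F 1%N -> F 1%N},
    forall x, e x = x - res_d F 1 (r x).
  by apply: linear_exists => a x y; rewrite !linearP /= scalerDr addrACA.
have [x dx0|y|s sE] := @linear_factor _ _ _ _ _ d e idfun.
- have /res_exact[z <-] : res_d F 0 x = 0 by rewrite -dE dx0 linear0.
  by rewrite eE rK subrr.
- have /res_exact0[x xE] := kernel_inclP y.
  by exists x; apply: kernel_incl_inj; rewrite dE.
have sK y : d (s y) = y.
  have /res_exact0[x xE] := kernel_inclP y.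
  have dx : d x = y by apply: kernel_incl_inj; rewrite dE.
  rewrite (sE y x) // -[RHS]dx; apply: kernel_incl_inj.
  by rewrite !dE eE linearB /= res_d0 subr0.
have [g gE] := @res_projective _ F _ _ _ p (f \o d)%FUN psurj.
by exists (g \o s)%FUN => y /=; rewrite gE /= sK.
Qed.

(** Only [m = 1] needs work: the resolution of length 1 gives [n <= 1], and [n <> 1] leaves
    [n = 0]. *)
Lemma duality_cohomology1 (G : groupType) (F : projective_resolution G)
    (n m : nat) :
    has_cd G n -> n <> 1%N -> finite_type F ->
    (forall i, i != m -> cohomology_zero F (regular_module G) i) ->
  cohomology_zero F (regular_module G) 1.
Proof.
move=> [[F' lenF'] cd_le] n1 ftF H0.
have [m1|m1] := eqVneq m 1%N; last by apply: H0; rewrite eq_sym.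
have [|F'' lenF''] := @short_resolution G F.
  by apply: projective_kernel_aug => // -[|[|i]] // _; apply: H0; rewrite m1.
have n0 : n = 0%N by move: (cd_le _ _ lenF'') n1; case: (n) => [|[]].
apply/cohomology1_zero_of_projective_trivZ/(length0_projective_trivZ (F := F')).
by rewrite -n0.
Qed.

(** * Cohomology of induced modules *)

(** The least positive element of [A] generates it by Euclidean division; [k = 0] covers the trivial
    subgroup. *)
Lemma int_subgroup_generator (A : int -> Prop) :
    A 0 -> (forall x y t, A x -> A y -> A (x - y * t)) ->
  exists k : nat, A k /\ forall z, A z -> (k %| z)%Z.
Proof.
move=> A0 AB.
have Aabs z : A z -> A `|z|%N.
  rewrite abszE; case: (Num.Theory.ger0P z) => // _ Az.
  by rewrite -[z]mulr1 -sub0r; apply: AB.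
have [[k /andP[k0 /asboolP Ak]]|noA] :=
  pselect (exists k : nat, (0 < k)%N && `[< A k >]).
  have exA : exists k : nat, (0 < k)%N && `[< A k >].
    by exists k; rewrite k0; apply/asboolP.
  case: (ex_minnP exA) => {k0 Ak}k /andP[k0 /asboolP Ak] kmin.
  exists k; split=> // z Az; apply/dvdz_mod0P.
  have Ar : A (z %% k)%Z.
    by rewrite /modz mulrC; apply: AB.
  have : (0 <= z %% k)%Z by rewrite modz_ge0 // -lt0n.
  have : (z %% k < k)%Z by rewrite ltz_pmod.
  case: (z %% k)%Z Ar => // r Ar rk _; case: (posnP r) => [-> //|r0].
  have := kmin r; rewrite r0 (introT (asboolP _) Ar) leqNgt -ltz_nat rk.
  by move=> /(_ isT).
exists 0%N; split=> // z /Aabs Az; rewrite dvd0z -absz_eq0.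
apply: contra_notT noA; rewrite -lt0n => z0; exists `|z|%N; rewrite z0.
exact/asboolP.
Qed.

(** * Finite combinations of generators of an induced module *)

Section InducedModule.
Variables (G : groupType) (W : lmodType (zgring G)) (J : Type) (b : J -> W).
Implicit Types (s : seq J) (v w : W).

Fixpoint zspan s v : Prop :=
  if s is j :: s' then exists z : int, zspan s' (v - b j *~ z) else v = 0.

(** The sums of [c_j(x) b_j] over [j] in [s], with linear forms [c_j]. Peeling off one form at a
    time serves the induction in [lspan_coboundary]. *)
Fixpoint lspan (U : lmodType (zgring G)) s (f : U -> W) : Prop :=
  if s is j :: s' then exists c : {linear U -> regular_module G},
    lspan s' (fun x => f x - (c x : zgring G) *: b j)
  else forall x, f x = 0.

Lemma zspan0 s : zspan s 0.
Proof. by elim: s => //= j s IHs; exists 0; rewrite mulr0z subr0. Qed.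

Lemma zspanB s u v t : zspan s u -> zspan s v -> zspan s (u - v *~ t).
Proof.
elim: s u v => /= [u v -> ->|j s IHs u v [x ux] [y vy]].
  by rewrite mul0rz subr0.
exists (x - y * t); have := IHs _ _ ux vy; congr zspan.
rewrite mulrzBl mulrzBr mulrzA !opprB -!addrA; congr (u + _).
by rewrite addrCA [RHS]addrC -addrA.
Qed.

Lemma eq_lspan (U : lmodType (zgring G)) s (f f' : U -> W) :
  f =1 f' -> lspan s f -> lspan s f'.
Proof.
elim: s f f' => [f f' ff' f0 x|j s IHs f f' ff' [c fc]]; first by rewrite -ff'.
by exists c; apply: IHs fc => x; rewrite ff'.
Qed.

Lemma lspanD (U : lmodType (zgring G)) s (f f' : U -> W) :
  lspan s f -> lspan s f' -> lspan s (f \+ f').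
Proof.
elim: s f f' => [f f' f0 f'0 x|j s IHs f f' [c fc] [c' f'c]] /=.
  by rewrite f0 f'0 addr0.
exists (c \+ c')%FUN; apply: eq_lspan (IHs _ _ fc f'c) => x /=.
by rewrite scalerDl opprD addrACA.
Qed.

Lemma lspan_scale (U : lmodType (zgring G)) (c : {linear U -> regular_module G})
    s v :
  zspan s v -> lspan s (fun x => (c x : zgring G) *: v).
Proof.
elim: s v => [v -> x|j s IHs v [z /IHs vz]] /=; first by rewrite scaler0.
have [c' c'E] : exists c' : {linear U -> regular_module G},
    forall x, c' x = c x *~ z.
  by apply: linear_exists => a x y; rewrite linearP mulrzDl scalerMzr.
exists c'; apply: eq_lspan vz => x.
by rewrite c'E scalerBr -scalerMzl -scalerMzr.
Qed.

Lemma lspan_rcons (U : lmodType (zgring G)) s j (f : U -> W)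
    (c : {linear U -> regular_module G}) :
  lspan s f -> lspan (rcons s j) (fun x => f x + (c x : zgring G) *: b j).
Proof.
elim: s f => [f f0|i s IHs f [c' fc]] /=.
  by exists c => x; rewrite f0 add0r subrr.
by exists c'; apply: eq_lspan (IHs _ fc) => x; rewrite addrAC.
Qed.

Lemma lspan_linear (U : lmodType (zgring G)) s (f : U -> W) :
  lspan s f -> exists h : {linear U -> W}, h =1 f.
Proof.
move=> fs; apply: linear_exists; elim: s f fs => [f f0 a x y|j s IHs f [c fc]].
  by rewrite !f0 scaler0 addr0.
have fE x : f x = f x - (c x : zgring G) *: b j + (c x : zgring G) *: b j.
  by rewrite subrK.
move=> a x y; rewrite fE (IHs _ fc) linearP.
rewrite scalerDl -scalerA addrACA -scalerDr !subrK //.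
Qed.

Hypothesis gen : forall w, exists s : seq (zgring G * J),
  w = \sum_(p <- s) p.1 *: b p.2.

(** A dual basis of [U] expresses [f] through the finitely many values [f (e i)], each of which
    involves only finitely many [b j]. *)
Lemma lspan_fg (U : lmodType (zgring G)) (f : {linear U -> W}) :
    projective_module U -> finitely_generated U -> exists s, lspan s f.
Proof.
move=> projU fgU; have [n [e [e' eK]]] := dual_basis projU fgU.
suff [s fs] : exists s,
    lspan s (fun x => \sum_i (e' i x : zgring G) *: f (e i)).
  exists s; apply: eq_lspan fs => x; rewrite [x in RHS]eK linear_sum.
  by apply: eq_bigr => i _; rewrite linearZ.
elim: (index_enum _) => [|i r [s IHs]].
  by exists [::] => x; rewrite big_nil.
have [t tE] := gen (f (e i)).
suff [s' s'P] : exists s', lspan s' (fun x =>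
    \sum_(i <- r) (e' i x : zgring G) *: f (e i)
      + (e' i x : zgring G) *: \sum_(p <- t) p.1 *: b p.2).
  by exists s'; apply: eq_lspan s'P => x; rewrite big_cons -tE addrC.
elim: t {tE} => [|[a j] t [s' IHt]].
  by exists s; apply: eq_lspan IHs => x; rewrite big_nil scaler0 addr0.
have [c cE] : exists c : {linear U -> regular_module G},
    forall x, c x = (e' i x : zgring G) * a.
  by apply: linear_exists => z x y; rewrite linearP mulrDl -mulrA.
exists (rcons s' j); apply: eq_lspan (lspan_rcons j c IHt) => x.
by rewrite big_cons /= cE scalerDr scalerA -!addrA; congr (_ + _); apply: addrC.
Qed.

(** [comp g] models the component at [g] of a module induced from the trivial group, translated back
    to the identity. It turns ZG-combinations of the [b j] into integer ones. *)
Variable comp : G -> W -> W.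
Hypothesis compD : forall g, {morph comp g : v w / v + w}.
Hypothesis comp_scale : forall g (x : zgring G) j,
  comp g (x *: b j) = b j *~ x@_g.

Lemma zspan_comp (U : lmodType (zgring G)) s (f : U -> W) x g :
  lspan s f -> zspan s (comp g (f x)).
Proof.
have comp0 : comp g 0 = 0 by apply: (addrI (comp g 0)); rewrite -compD !addr0.
elim: s f => [f f0|j s IHs f [c fc]] /=; first by rewrite f0.
exists (c x : zgring G)@_g; have := IHs _ fc.
have compN v : comp g (- v) = - comp g v.
  by apply: (addrI (comp g v)); rewrite -compD !subrr.
by rewrite compD compN comp_scale.
Qed.

End InducedModule.

Lemma zgring_divn (G : groupType) (k : nat) (x : zgring G) :
    (0 < k)%N -> (forall g, (k %| x@_g)%Z) ->
  exists y : zgring G, y *+ k = x.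
Proof.
move=> k0 kx; exists [malg g in msupp x => (x@_g %/ k)%Z].
apply/malgP => g; rewrite mcoeffMn mcoeffE; case: msuppP => [gx|_].
  by rewrite -mulr_natr natz divzK.
by rewrite mul0rn.
Qed.

Section InducedCohomology.
Variables (G : groupType) (F : projective_resolution G).
Hypothesis ftF : finite_type F.
Hypothesis H1 : cohomology_zero F (regular_module G) 1.
Hypothesis H2 : cohomology_torsion_free F (regular_module G) 2.
Variables (W : lmodType (zgring G)) (J : Type) (b : J -> W).
Hypothesis gen : forall w, exists s : seq (zgring G * J),
  w = \sum_(p <- s) p.1 *: b p.2.
Variable comp : G -> W -> W.
Hypothesis compD : forall g, {morph comp g : v w / v + w}.
Hypothesis comp_scale : forall g (x : zgring G) j,
  comp g (x *: b j) = b j *~ x@_g.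

(** Universal coefficients in the form [H^1(G, ZG/k) = 0]. The coboundary of [f] is [k] times some
    [c]; torsion-freeness in degree 2 makes [c] the coboundary of some [h], and [f - k h] is a
    genuine cocycle. For [k = 0] the hypothesis says that [f] is a cocycle. *)
Lemma coboundary_mod (k : nat) (f : {linear F 1%N -> regular_module G}) :
    (forall y g, (k %| (f (res_d F 1 y) : zgring G)@_g)%Z) ->
  exists (h : {linear F 1%N -> regular_module G})
         (l : {linear F 0%N -> regular_module G}),
    forall x, f x = h x *+ k + l (res_d F 0 x).
Proof.
have [-> f0|k0 kf] := posnP k.
  have [y|l lE] := H1 (f := f).
    apply/malgP => g; rewrite mcoeff0; apply/eqP.
    by rewrite -dvd0z.
  by exists (\0)%FUN, l => x; rewrite mulr0n add0r lE.
have [mk mkE] : exists mk : {linear regular_module G -> regular_module G},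
    forall x, mk x = x *+ k.
  by apply: linear_exists => a x y; rewrite mulrnDl scalerMnr.
have kI (x : regular_module G) : x *+ k = 0 -> x = 0.
  move=> /malgP xk0; apply/malgP => g; move: (xk0 g).
  rewrite mcoeffMn !mcoeff0 => /eqP; rewrite Num.Theory.mulrn_eq0.
  by rewrite gtn_eqF // => /eqP.
have [x|y|c cE] := @linear_factor _ _ _ _ _ mk idfun (f \o res_d F 1%N)%FUN.
- by rewrite mkE => /kI.
- have [z zE] := zgring_divn k0 (kf y); exists z.
  by rewrite mkE.
have ck y : c y *+ k = f (res_d F 1 y).
  have [z zE] := zgring_divn k0 (kf y).
  by rewrite (cE y z) // mkE.
have [y||h hE] := H2 (f := c) (k := k) _ k0.
- by apply: kI; rewrite ck res_d0 linear0.
- by exists f => y; rewrite ck.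
have [l lE] : exists l : {linear F 1%N -> regular_module G},
    forall x, l x = f x - h x *+ k.
  apply: linear_exists => a x y; rewrite !linearP mulrnDl scalerBr.
  by rewrite opprD addrACA scalerMnr.
have [y|l' l'E] := H1 (f := l).
  by rewrite lE -hE ck subrr.
by exists h, l' => x; rewrite -l'E lE addrC subrK.
Qed.

(* The last coefficient of a cocycle is a cocycle modulo the ideal
   [kZ] of the multiples of [b j] lying in the span of the other elements, so
   up to a coboundary it is divisible by [k] and can be absorbed in them. *)
Lemma lspan_coboundary s (f : {linear F 1%N -> W}) :
    lspan b s f -> cocycle f ->
  exists h : {linear F 0%N -> W}, forall x, f x = h (res_d F 0 x).
Proof.
elim: s f => [f f0 _|j s IHs f [c fc] cf]; first by exists (\0)%FUN.
have [v vE] := lspan_linear fc.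
have vs : lspan b s v by apply: eq_lspan fc => x; rewrite vE.
have [||k [ks kmin]] :=
  @int_subgroup_generator (fun z => zspan b s (b j *~ z)).
- exact: zspan0.
- by move=> x y t xs ys; rewrite mulrzBr mulrzA; apply: zspanB.
(* As [f (d y) = 0], its component at [g] shows that [b j] times the coefficient of [c (d y)] at [g]
   lies in the integer span of [s], so that [k] divides this coefficient. *)
have [y g|h [l cE]] := @coboundary_mod k c.
  apply: kmin; have := zspan_comp compD comp_scale (res_d F 1 y) g vs.
  rewrite vE cf sub0r -scaleNr comp_scale => /(zspanB 1 (zspan0 b s)).
  by rewrite mulr1z mcoeffN mulrNz opprK add0r.
have [f' f'E] : exists f' : {linear F 1%N -> W},
    forall x, f' x = f x - (l (res_d F 0 x) : zgring G) *: b j.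
  apply: linear_exists => a x y; rewrite !linearP scalerDl -scalerA.
  by rewrite opprD addrACA scalerBr.
have [||h' h'E] := IHs f'.
- apply: eq_lspan (lspanD vs (lspan_scale h ks)) => x /=.
  rewrite f'E vE cE scalerDl opprD addrA.
  by rewrite [f x - _ - _]addrAC -pmulrn -scalerMnr scalerMnl subrK.
- by move=> y; rewrite f'E cf res_d0 linear0 scale0r subrr.
have [g gE] : exists g : {linear F 0%N -> W},
    forall x, g x = h' x + (l x : zgring G) *: b j.
  apply: linear_exists => a x y; rewrite !linearP scalerDl -scalerA.
  by rewrite addrACA scalerDr.
by exists g => x; rewrite gE -h'E f'E subrK.
Qed.

Lemma induced_cohomology1_zero : cohomology_zero F W 1.
Proof.
move=> f cf.
have [s fs] := lspan_fg gen f (@res_projective _ F 1%N) (ftF.2 1%N).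
exact: lspan_coboundary fs cf.
Qed.

End InducedCohomology.

(** * Group cocycles *)

Lemma additive_exists (U V : zmodType) (f : U -> V) :
  {morph f : u v / u + v} -> exists h : {additive U -> V}, h =1 f.
Proof.
move=> fD; have fB : zmod_morphism f.
  by move=> u v; apply: (addIr (f v)); rewrite -fD !subrK.
pose m := GRing.isZmodMorphism.Build U V f fB.
by exists (HB.pack_for {additive U -> V} f m).
Qed.

Section GroupElements.
Variable G : groupType.

Definition zgelt (g : G) : zgring G := << 1 *g g >>.

Lemma zgringE (a : zgring G) : a = \sum_(g <- msupp a) zgelt g *~ a@_g.
Proof.
by rewrite [LHS]monalgE; apply: eq_bigr => g _; rewrite [RHS]malgUMz mul1r.
Qed.

Lemma gmodule_zgelt (M : zmodType) (r : gaction G M) g (u : gmodule r) :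
  zgelt g *: u = r g u.
Proof. by rewrite [LHS]gmodule_scaleE malg_extU mulr1z. Qed.

Lemma linear_of_zgelt (U V : lmodType (zgring G)) (f : U -> V) :
    {morph f : u v / u + v} ->
    (forall g u, f (zgelt g *: u) = zgelt g *: f u) ->
  linear f.
Proof.
move=> fD fg a u v; rewrite fD; congr (_ + _).
have [f' f'E] := additive_exists fD.
rewrite -!f'E (zgringE a) !scaler_suml raddf_sum; apply: eq_bigr => g _.
by rewrite -!scalerMzl raddfMz /= !f'E fg.
Qed.

End GroupElements.

Section CocycleExtension.
Variables (G : groupType) (W : zmodType) (r : gaction G W) (beta : G -> W).
Hypothesis betaM : forall g h, beta (g * h)%g = beta g + r g (beta h).

Definition ext_act (g : G) (w : W * int) : W * int :=
  (r g w.1 + beta g *~ w.2, w.2).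

Lemma ext_actD g : {morph ext_act g : u v / u + v}.
Proof. by move=> u v; rewrite /ext_act /= gactD mulrzDr addrACA. Qed.

Lemma ext_act1 u : ext_act 1%g u = u.
Proof.
have beta1 : beta 1%g = 0.
  apply: (addrI (beta 1%g)).
  by rewrite -[X in _ + X](gact1 r) -betaM mulg1 addr0.
by case: u => w k; rewrite /ext_act beta1 mul0rz addr0 gact1.
Qed.

Lemma ext_actM g h u : ext_act (g * h)%g u = ext_act g (ext_act h u).
Proof.
rewrite /ext_act /= gactM betaM gactD gactMz mulrzDl.
by rewrite -addrA [_ *~ _ + _ in RHS]addrC.
Qed.

Definition ext_gaction : gaction G (W * int)%type :=
  GAction ext_actD ext_act1 ext_actM.

(* [beta] is the obstruction to splitting the extension of [trivZ G] by [W]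
   that it defines; the augmentation lifts to this extension, and the lift can
   be corrected so as to factor through [trivZ G]. *)
Lemma group_cocycle_coboundary (F : projective_resolution G) :
  cohomology_zero F (gmodule r) 1 -> exists m, forall g, beta g = m - r g m.
Proof.
move=> H1; pose E : lmodType (zgring G) := gmodule ext_gaction.
have [pr prE] : exists pr : {linear E -> trivZ G}, forall w, pr w = w.2.
  apply: linear_exists; apply: linear_of_zgelt => [u v //|g u].
  by rewrite !gmodule_zgelt.
have [io ioE] : exists io : {linear gmodule r -> E}, forall w, io w = (w, 0).
  apply: linear_exists; apply: linear_of_zgelt => [u v|g u].
    by congr pair; rewrite addr0.
  by rewrite !gmodule_zgelt /= /ext_act /= mulr0z addr0.
have ioI w : io w = 0 -> w = 0 by rewrite ioE => -[].
have [|b bE] := @res_projective _ F 0%N _ _ pr (res_aug F).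
  by move=> k; exists (0, k); rewrite prE.
have [x|f fE] := @linear_factor _ _ _ _ _ io idfun (b \o res_d F 0%N)%FUN ioI.
  have : (b (res_d F 0 x)).2 = 0 by rewrite -prE bE res_aug0.
  by rewrite /=; case: (b _) => w k /= ->; exists w; rewrite ioE.
have iof x : io (f x) = b (res_d F 0 x).
  have : (b (res_d F 0 x)).2 = 0 by rewrite -prE bE res_aug0.
  case bx : (b _) => [w k] /= k0; have wE : io w = (b \o res_d F 0%N)%FUN x.
    by rewrite /= bx k0 ioE.
  by rewrite (fE _ _ wE) wE /= bx.
have [y|h hE] := H1 f; first by apply: ioI; rewrite iof res_d0 linear0.
have [e e1] := res_aug_surj F 1.
have bh0 x : res_aug F x = 0 -> b x = io (h x).
  by move=> /res_exact0[y <-]; rewrite -iof hE.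
(* The corrected lift [b - io h] vanishes on the kernel of the augmentation and takes the value
   [(m, 1)] at [e], with [m] this witness. As [g e - e] lies in that kernel, [g] fixes [(m, 1)],
   which reads [r g m + beta g = m]. *)
exists ((b e).1 - h e) => g.
have := bh0 (zgelt g *: e - e).
rewrite linearB linearZ /= e1 gmodule_zgelt subrr => /(_ erefl).
rewrite !linearB !linearZ /= !gmodule_zgelt ioE /=.
case be : (b e) => [w k]; have -> : k = 1 by rewrite -e1 -bE prE be.
move=> /(congr1 fst) /=; rewrite mulr1z mulr0z addr0.
have -> : r g w = r g (w - h e) + r g (h e) by rewrite -gactD subrK.
move: (h e) => x; move: (r g (w - x)) (r g x) => A B eqAB.
apply: (addrI (A + B)); apply: (addIr (- w)); rewrite eqAB.
rewrite [A + B]addrC -(addrA B) -(addrA B); congr (B + _).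
by rewrite [w - x - A]addrAC addrA (addrC A) subrK addrAC subrr add0r.
Qed.

End CocycleExtension.

(** * Locally constant functions *)

Section LocallyConstant.
Variable X : topologicalType.

Definition locally_constant (T : Type) (v : X -> T) :=
  forall x, \forall y \near x, v y = v x.

Lemma locally_constant_comp (T S : Type) (h : T -> S) (v : X -> T) :
  locally_constant v -> locally_constant (h \o v).
Proof. by move=> vl x; apply: filterS (vl x) => y /= ->. Qed.

Lemma locally_constant2 (S T U : Type) (h : S -> T -> U) v w :
    locally_constant v -> locally_constant w ->
  locally_constant (fun x => h (v x) (w x)).
Proof. by move=> vl wl x; apply: filterS2 (vl x) (wl x) => y /= -> ->. Qed.

Lemma locally_constant_finite_range (T : choiceType) (v : X -> T) :
    compact [set: X] -> locally_constant v ->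
  exists t : seq T, uniq t /\ forall e, e \in t <-> exists x, v x = e.
Proof.
move=> /compact_near_coveringP Xc vl.
(* A set of lists is large if it has as members all lists that contain a given one. Compactness
   along this filter bounds the range of [v] by one list [D]. *)
pose eventually : set_system (seq T) :=
  [set A | exists t0 : seq T, forall t, {subset t0 <= t} -> A t].
have evF : Filter eventually.
  split=> [|A B [tA At] [tB Bt]|A B AB [tA At]].
  - by exists [::].
  - exists (tA ++ tB) => t /(_ _)sub; split; [apply: At|apply: Bt] => e te.
      by apply: sub; rewrite mem_cat te.
    by apply: sub; rewrite mem_cat te orbT.
  - by exists tA => t /At /AB.
have [|D DX] := Xc _ eventually (fun t x => v x \in t) evF.
  move=> x _; exists ([set y | v y = v x], [set t | v x \in t]).
    split; first exact: vl.
    by exists [:: v x] => t; apply; rewrite mem_head.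
  by move=> [y t] [/= -> ].
exists [seq e <- undup D | `[< exists x, v x = e >]]; split.
  exact/filter_uniq/undup_uniq.
move=> e; rewrite mem_filter mem_undup; split=> [/andP[/asboolP//]|ve].
apply/andP; split; first exact/asboolP.
by case: ve => x <-; exact: (DX D).
Qed.

Lemma indicator_exists (T : choiceType) (v : X -> T) : locally_constant v ->
  exists chi : T -> CXZ X, forall e y, chi e y = (v y == e)%:Z :> int.
Proof.
move=> vl; have chic e :
    continuous ((fun y => (v y == e)%:Z) : X -> discrete_topology int).
  apply/discrete_continuousP.
  exact: (locally_constant_comp (fun t => (t == e)%:Z) vl).
by exists (fun e => mkcts (chic e)).
Qed.

Lemma sum_indicator (T : choiceType) (V : zmodType) (t : seq T) (f : T -> V)
    e0 :
  uniq t -> e0 \in t -> \sum_(e <- t) f e *~ (e0 == e)%:Z = f e0.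
Proof.
move=> tU te0; rewrite (bigD1_seq e0) //= eqxx mulr1z big1 ?addr0 // => e.
by rewrite eq_sym => /negPf ->; rewrite mulr0z.
Qed.

Lemma CXZ_evalMz (c : CXZ X) z x : (c *~ z) x = c x * z :> int.
Proof.
have [h hE] := @additive_exists (CXZ X) int (fun c => c x) (fun _ _ => erefl).
by rewrite -hE raddfMz hE mulrzz.
Qed.

Lemma CXZ_eval_sum (I : Type) (s : seq I) (f : I -> CXZ X) x :
  (\sum_(i <- s) f i) x = \sum_(i <- s) (f i x : int) :> int.
Proof.
have [h hE] := @additive_exists (CXZ X) int (fun c => c x) (fun _ _ => erefl).
by rewrite -hE raddf_sum; apply: eq_bigr => i _; rewrite hE.
Qed.

(** * Locally constant functions as a tensor product *)

Section Tensor.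
Hypothesis Xc : compact [set: X].
Variable N : zmodType.
Implicit Types (s : seq (CXZ X * N)).

Lemma simple_function_rep (f : X -> N) : locally_constant f ->
  exists s, forall x, f x = \sum_(p <- s) p.2 *~ (p.1 x : int).
Proof.
move=> fl; have [t [tU tE]] := locally_constant_finite_range Xc fl.
have [chi chiE] := indicator_exists fl.
exists [seq (chi n, n) | n <- t] => x; rewrite big_map.
rewrite -[LHS](@sum_indicator _ _ t id) //; last by apply/tE; exists x.
by apply: eq_bigr => n _ /=; rewrite chiE.
Qed.

(* The tensor product of [C(X, Z)] with [N] is the group of locally constant
   functions: relations are checked on a finite clopen partition of [X]. *)
Lemma tensor_relation (V : zmodType) (B : CXZ X -> N -> V) s :
    (forall c, {morph B c : u v / u + v}) ->
    (forall n, {morph B^~ n : c d / c + d}) ->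
    (forall x, \sum_(p <- s) p.2 *~ (p.1 x : int) = 0) ->
  \sum_(p <- s) B p.1 p.2 = 0.
Proof.
move=> Br Bl s0.
(* [v x] lists the values at [x] of all the functions in [s]; its fibres form the finite clopen
   partition on whose pieces they are all constant. *)
pose v (x : X) := [seq (p.1 x : int) | p : (CXZ X * N)%type <- s].
have vl : locally_constant v.
  rewrite /v; elim: (s) => [|p s' IHs] x; first exact: nearW.
  by apply: filterS2 (CXZ_near p.1 x) (IHs x) => y /= -> ->.
have [t [tU tE]] := locally_constant_finite_range Xc vl.
have [chi chiE] := indicator_exists vl.
have BMz c n z : B (c *~ z) n = B c (n *~ z).
  have [h hE] := additive_exists (Br c); have [k kE] := additive_exists (Bl n).
  by rewrite -hE -kE !raddfMz hE kE.
have pE i : (i < size s)%N ->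
    forall d, B (nth d s i).1 (nth d s i).2
      = \sum_(e <- t) B (chi e) ((nth d s i).2 *~ nth 0 e i).
  move=> si d; set p := nth d s i.
  have [k kE] := additive_exists (Bl p.2).
  rewrite -kE.
  have -> : p.1 = \sum_(e <- t) chi e *~ nth 0 e i.
    apply/continuousEP => x; rewrite CXZ_eval_sum.
    have := @sum_indicator _ int t (fun e => nth 0 e i) (v x) tU.
    rewrite {2}/v (nth_map d) // => <-; last by apply/tE; exists x.
    by apply: eq_bigr => e _; rewrite CXZ_evalMz chiE mulrzz mulrC.
  by rewrite raddf_sum; apply: eq_bigr => e _; rewrite kE BMz.
pose d : CXZ X * N := (0, 0).
rewrite (big_nth d) big_mkord.
rewrite (eq_bigr _ (fun (i : 'I_(size s)) _ => pE i (ltn_ord i) d)).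
rewrite exchange_big big_seq big1 //= => e /tE[x <-].
have [k kE] := additive_exists (Br (chi (v x))).
(* The terms for the piece containing [x] collect into [B (chi (v x))] applied to the given relation
   at [x], which is zero. *)
transitivity (k (\sum_(i < size s) (nth d s i).2 *~ nth 0 (v x) i)).
  by rewrite raddf_sum; apply: eq_bigr => i _; rewrite kE.
rewrite (_ : \sum_(i < _) _ = 0) ?raddf0 // -[RHS](s0 x).
rewrite (big_nth d) big_mkord; apply: eq_bigr => i _.
by rewrite (nth_map d).
Qed.

End Tensor.
End LocallyConstant.

Lemma locally_constant_precomp (X Y : topologicalType) (T : Type) (v : X -> T)
    (k : Y -> X) :
  locally_constant v -> continuous k -> locally_constant (v \o k).
Proof. by move=> vl kc y; exact: kc y _ (vl (k y)). Qed.

(** * Rigidity for abelian coefficients *)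

Section MalgSum.
Variables (K : choiceType) (N V : zmodType).

Lemma malg_additive_ext (f f' : {malg N[K]} -> V) :
    {morph f : u v / u + v} -> {morph f' : u v / u + v} ->
    (forall n k, f << n *g k >> = f' << n *g k >>) ->
  f =1 f'.
Proof.
move=> fD f'D ff' w.
have [h hE] := additive_exists fD; have [h' h'E] := additive_exists f'D.
rewrite -hE -h'E (monalgE w) !raddf_sum; apply: eq_bigr => k _.
by rewrite hE h'E ff'.
Qed.

Variable f : K -> N -> V.
Hypothesis fD : forall k, {morph f k : u v / u + v}.

Definition malg_sum (w : {malg N[K]}) : V := \sum_(k <- msupp w) f k w@_k.

Lemma malg_sumEw (d : {fset K}) (w : {malg N[K]}) :
  (msupp w `<=` d)%fset -> malg_sum w = \sum_(k <- d) f k w@_k.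
Proof.
move=> le_wd; rewrite /malg_sum (big_fset_incl _ le_wd) //= => k _.
have [h hE] := additive_exists (fD k).
by move=> /mcoeff_outdom ->; rewrite -hE raddf0.
Qed.

Lemma malg_sumD : {morph malg_sum : u v / u + v}.
Proof.
move=> u v.
rewrite (malg_sumEw (fsubsetUl (msupp u) (msupp v))).
rewrite (malg_sumEw (fsubsetUr (msupp u) (msupp v))).
rewrite (malg_sumEw (msuppD_le u v)) -big_split /=.
by apply: eq_bigr => k _; rewrite mcoeffD fD.
Qed.

Lemma malg_sumU n k : malg_sum << n *g k >> = f k n.
Proof.
by rewrite (malg_sumEw (@msuppU_le _ _ k n)) big_seq_fset1 mcoeffUU.
Qed.

End MalgSum.

(** * Free modules tensored with [N], as induced modules *)

Section TwistedModule.
Variables (G : groupType) (I : choiceType) (N : zmodType) (r : gaction G N).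
Let W := {malg N[(G * I)%type]}.

(** The diagonal action on the tensor product of the free module on [I] with [N]: the monomial of
    coefficient [n] at [(h, i)] stands for [h i] tensor [n]. For [N = int] with trivial action this
    is the free module itself. *)
Definition tw_act (g : G) (w : W) : W :=
  malg_sum (fun k n => << r g n *g ((g * k.1)%g, k.2) >>) w.

Fact tw_termD g k :
  {morph (fun n => << r g n *g ((g * k.1)%g, k.2) >> : W) : u v / u + v}.
Proof. by move=> u v; rewrite gactD monalgUD. Qed.

Lemma tw_actD g : {morph tw_act g : u v / u + v}.
Proof. exact: (malg_sumD (tw_termD g)). Qed.

Lemma tw_actU g n h i :
  tw_act g << n *g (h, i) >> = << r g n *g ((g * h)%g, i) >>.
Proof. exact: (malg_sumU (tw_termD g)). Qed.

Lemma tw_act1 w : tw_act 1%g w = w.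
Proof.
move: w; apply: malg_additive_ext => [|u v //|n [h i]]; first exact: tw_actD.
by rewrite tw_actU gact1 mul1g.
Qed.

Lemma tw_actM g h w : tw_act (g * h)%g w = tw_act g (tw_act h w).
Proof.
move: w; apply: malg_additive_ext => [|u v|n [k i]]; first exact: tw_actD.
  by rewrite !tw_actD.
by rewrite !tw_actU gactM mulgA.
Qed.

Definition tw_gaction : gaction G W := GAction tw_actD tw_act1 tw_actM.

Definition tw_unit (j : (N * I)%type) : gmodule tw_gaction :=
  << j.1 *g (1%g, j.2) >>.

(** The twist by [r] is absorbed: [n] at [(h, i)] is the translate by [h] of [h^-1 n] at
    [(1, i)]. *)
Lemma tw_gen (w : gmodule tw_gaction) : exists s : seq (zgring G * (N * I))%type,
  w = \sum_(p <- s) p.1 *: tw_unit p.2.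
Proof.
exists [seq (zgelt k.1, (r k.1^-1%g (w : W)@_k, k.2)) | k <- msupp (w : W)].
rewrite big_map [LHS]monalgE; apply: eq_bigr => -[h i] _ /=.
by rewrite gmodule_zgelt [RHS]tw_actU -gactM mulgV gact1 mulg1.
Qed.

Let unit_part (k : (G * I)%type) (n : N) : W :=
  if k.1 == 1%g then << n *g k >> else 0.

Fact unit_partD k : {morph unit_part k : u v / u + v}.
Proof.
by move=> u v; rewrite /unit_part; case: ifP => _; rewrite ?addr0 ?monalgUD.
Qed.

Definition tw_comp (g : G) (w : gmodule tw_gaction) : gmodule tw_gaction :=
  malg_sum unit_part (tw_act g^-1%g w).

Lemma tw_compD g : {morph tw_comp g : v w / v + w}.
Proof.
by move=> v w; rewrite /tw_comp [tw_act _ _]tw_actD (malg_sumD unit_partD).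
Qed.

Lemma tw_comp_scale g (x : zgring G) j :
  tw_comp g (x *: tw_unit j) = tw_unit j *~ x@_g.
Proof.
move: x; apply: (@malg_additive_ext G int) => [x y|x y|z h].
- by rewrite scalerDl tw_compD.
- by rewrite mcoeffD mulrzDr.
have -> : << z *g h >> = zgelt h *~ z by rewrite [RHS]malgUMz mul1r.
have [f fE] := additive_exists (tw_compD g).
rewrite -scalerMzl -fE raddfMz fE [mcoeff g _]raddfMz /= mcoeffU.
rewrite [X in tw_comp g X]gmodule_zgelt [X in tw_comp g X]tw_actU mulg1.
rewrite /tw_comp tw_actU (malg_sumU unit_partD) /unit_part /=.
have -> : ((g^-1 * h)%g == 1%g) = (h == g).
  by rewrite -(inj_eq (mulgI g)) mulVKg mulg1.
case: eqP => [->|_]; last by rewrite !mul0rz mulr0z.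
by rewrite -gactM mulVg gact1 mulrzz mul1r.
Qed.

Lemma tw_cohomology1_zero (F : projective_resolution G) :
    finite_type F -> cohomology_zero F (regular_module G) 1 ->
    cohomology_torsion_free F (regular_module G) 2 ->
  cohomology_zero F (gmodule tw_gaction) 1.
Proof.
move=> ftF H1 H2.
exact: (induced_cohomology1_zero ftF H1 H2 tw_gen tw_compD tw_comp_scale).
Qed.

End TwistedModule.

(** [P] is a retract of the free module on its own underlying set, so [I] is [P] and [q] is its
    inclusion in [C(X, Z)]. [tau] is the projection onto the constants, and [s] gives free
    coordinates of the remaining part. *)
Lemma almost_projective_coordinates (G : groupType) (X : topologicalType)
    (act : dynamical_system G X) :
  almost_ZG_projective act ->
  exists (tau : CXZ X -> int) (I : choiceType) (q : I -> CXZ X)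
         (s : CXZ X -> {malg int[(G * I)%type]}),
    [/\ {morph s : c d / c + d},
        forall g c, s (CXZ_act act g c)
          = tw_act (trivial_gaction G int) g (s c),
        forall c : CXZ X, (forall x, c x = 1 :> int) -> s c = 0 &
        forall (c : CXZ X) x, (c x : int) = tau c
          + malg_ext (fun k => q k.2 (act k.1^-1%g x) : int) (s c)].
Proof.
move=> [P [projP [phi [[phi' phiK phi'K] phi1]]]].
pose W := gmodule (tw_gaction P (trivial_gaction G int)).
have phi'P : linear phi'.
  by move=> a u v; apply: (can_inj phiK); rewrite linearP !phi'K.
have [p pE] : exists p : {linear W -> P},
    forall w, p w = malg_ext (fun k => zgelt k.1 *: k.2) w.
  apply: linear_exists; apply: linear_of_zgelt => [u v|g].
    exact: malg_extD.
  apply: (@malg_additive_ext (G * P)%type int) => [u v|u v|n [h i]].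
  - by rewrite !gmodule_zgelt gactD; apply: malg_extD.
  - by rewrite malg_extD scalerDr.
  rewrite gmodule_zgelt [X in malg_ext _ X]tw_actU !malg_extU /=.
  by rewrite -scalerMzr scalerA [zgelt g * _]zgring_mulUU mulr1.
have [y|sp spE] := projP _ _ p idfun.
  exists << 1 *g (1%g, y) >>; rewrite pE malg_extU mulr1z; exact: scale1r.
have phi'D u v : phi' (u + v) = phi' u + phi' v.
  by have := phi'P 1 u v; rewrite !scale1r.
have phi'Z g c : phi' (CXZ_act act g c) = zgelt g *: phi' c.
  apply: (can_inj phiK); rewrite linearZ /= !phi'K.
  by rewrite gmodule_zgelt.
have phi'1 (c : CXZ X) : (forall x, c x = 1 :> int) -> phi' c = (1, 0).
  move=> c1; apply: (can_inj phiK); rewrite phi'K; apply/continuousEP => x.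
  by rewrite phi1 c1.
exists (fun c => (phi' c).1), P, (fun i => phi (0, i)),
  (fun c => sp (phi' c).2).
split.
- by move=> c d; rewrite phi'D /= raddfD.
- by move=> g c; rewrite phi'Z /= linearZ /= gmodule_zgelt.
- by move=> c /phi'1 -> /=; rewrite linear0.
move=> c x; have cE : c = phi (phi' c) by rewrite phi'K.
rewrite [in LHS]cE; move: {cE}(phi' c) => [k y] /=.
have -> : (k, y) = (k, 0) + (0, y) by congr pair; rewrite ?addr0 ?add0r.
rewrite linearD -[LHS]/((phi (k, 0) : CXZ X) x + (phi (0, y) : CXZ X) x).
rewrite phi1; congr (_ + _).
have evD : {morph (fun y => (phi (0, y) : CXZ X) x : int) : u v / u + v}.
  move=> u v; have -> : (0, u + v) = (0, u) + (0, v) :> (trivZ G * P)%type.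
    by congr pair; rewrite addr0.
  by rewrite linearD.
have [ev evE] := additive_exists evD.
rewrite -[y in LHS]spE pE -[LHS]evE; move: (sp y).
apply: (@malg_additive_ext (G * P)%type int) => [u v|u v|n [h i]].
- by rewrite malg_extD raddfD.
- exact: malg_extD.
rewrite !malg_extU raddfMz evE /=; congr (_ *~ _).
have -> : (0, zgelt h *: i) = zgelt h *: (0, i) :> (trivZ G * P)%type.
  by congr pair; rewrite scaler0.
by rewrite linearZ /= gmodule_zgelt.
Qed.

(** [T c n] is the coordinate vector of [c] tensored with [n], and [psi] evaluates vectors back to
    functions on [X]. Their composite loses exactly the average given by [tau]. *)
Lemma tensor_embedding (G : groupType) (X : topologicalType)
    (act : dynamical_system G X) (N : zmodType) (r : gaction G N) :
  almost_ZG_projective act ->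
  exists (tau : CXZ X -> int) (I : choiceType)
         (T : CXZ X -> N -> {malg N[(G * I)%type]})
         (psi : {malg N[(G * I)%type]} -> X -> N),
    [/\ forall c, {morph T c : m n / m + n},
        forall n, {morph T^~ n : c d / c + d},
        forall g c n, T (CXZ_act act g c) (r g n) = tw_gaction I r g (T c n) &
        forall (c : CXZ X) n, (forall x, c x = 1 :> int) -> T c n = 0] /\
    [/\ forall x, {morph psi^~ x : v w / v + w},
        forall g w x, psi (tw_gaction I r g w) x = r g (psi w (act g^-1%g x)),
        forall w, locally_constant (psi w) &
        forall (c : CXZ X) n x, psi (T c n) x = n *~ (c x : int) - n *~ tau c].
Proof.
move=> act_ap.
have [tau [I [q [s [sD sG s1 CE]]]]] := almost_projective_coordinates act_ap.
pose T (d : CXZ X) (n : N) : {malg N[(G * I)%type]} :=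
  malg_ext (fun k => << n *g k >>) (s d).
pose Q x (k : (G * I)%type) (n : N) : N := n *~ (q k.2 (act k.1^-1%g x) : int).
have QD x k : {morph Q x k : u v / u + v}.
  by move=> u v; rewrite /Q mulrzDl.
have psiD x : {morph malg_sum (Q x) : u v / u + v}.
  exact: (malg_sumD (QD x)).
exists tau, I, T, (fun w x => malg_sum (Q x) w); split; split => //.
- move=> d u v; rewrite /T /malg_ext -big_split; apply: eq_bigr => k _.
  by rewrite monalgUD mulrzDl.
- by move=> n d e; rewrite /T sD malg_extD.
- move=> g d n; rewrite /T sG; move: (s d).
  apply: (@malg_additive_ext (G * I)%type int) => [u v|u v|z [h i]].
  + by rewrite tw_actD malg_extD.
  + by rewrite malg_extD gactD.
  by rewrite tw_actU !malg_extU gactMz [tw_gaction _ _ _ _]tw_actU.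
- by move=> d n /s1 s0; rewrite /T s0 malg_ext0.
- move=> g w x; move: w; apply: malg_additive_ext => [u v|u v|n [h i]].
  + by rewrite gactD psiD.
  + by rewrite psiD gactD.
  rewrite [tw_gaction _ _ _ _]tw_actU !(malg_sumU (QD _)) /Q /= gactMz.
  by rewrite invgM dactM.
- move=> w x; rewrite /malg_sum; elim: (enum_fset _) => [|k t IHt].
    by apply: nearW => y; rewrite !big_nil.
  have qk := locally_constant_precomp (CXZ_near (q k.2))
    (@dact_continuous _ _ act k.1^-1%g) x.
  by apply: filterS2 IHt qk => y /= IHy qy; rewrite !big_cons IHy /Q qy.
move=> d n x; rewrite CE mulrzDr addrAC subrr add0r /T; move: (s d).
apply: (@malg_additive_ext (G * I)%type int) => [u v|u v|z k].
- by rewrite malg_extD psiD.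
- by rewrite malg_extD mulrzDr.
have [f fE] := additive_exists (psiD x).
rewrite !malg_extU -fE raddfMz fE (malg_sumU (QD x)) /Q.
by rewrite -!mulrzA mulrzz.
Qed.

(** [T] kills constants, so the defect [c g h] disappears and the image [beta] of [b] is a genuine
    cocycle in an induced module, hence the coboundary of some [m]. Applying [psi] recovers [b g] up
    to its average [t g]. *)
Lemma abelian_rigidity (G : groupType) (X : topologicalType)
    (act : dynamical_system G X) (F : projective_resolution G)
    (N : zmodType) (r : gaction G N) (b : G -> X -> N) (c : G -> G -> N) :
    compact [set: X] -> almost_ZG_projective act -> finite_type F ->
    cohomology_zero F (regular_module G) 1 ->
    cohomology_torsion_free F (regular_module G) 2 ->
    (forall g, locally_constant (b g)) ->
    (forall g h x, b (g * h)%g x = b g x + r g (b h (act g^-1%g x)) + c g h) ->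
  exists (t : G -> N) (u : X -> N), locally_constant u /\
    forall g x, b g x = t g + (u x - r g (u (act g^-1%g x))).
Proof.
move=> Xc act_ap ftF H1 H2 bl bM.
have [tau [I [T [psi [[Tr Tl TG T1] [psiD psiG psil psiT]]]]]] :=
  tensor_embedding r act_ap.
have [S SE] := choice (fun g => simple_function_rep Xc (bl g)).
pose beta g := \sum_(p <- S g) T p.1 p.2.
have betaM g h : beta (g * h)%g = beta g + tw_gaction I r g (beta h).
  have TN d n : T d (- n) = - T d n.
    by have [f fE] := additive_exists (Tr d); rewrite -!fE raddfN.
  have rN n : r g (- n) = - r g n.
    by have [f fE] := additive_exists (gactD r g); rewrite -!fE raddfN.
  pose one : CXZ X := cst (1 : int).
  (* The list encodes [bM] with all terms on one side. Keeping [B] arbitrary lets one computation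
     serve both for [T] and for evaluation at a point. *)
  have sumE (V : zmodType) (B : CXZ X -> N -> V) :
      \sum_(p <- S (g * h)%g ++ [seq (p.1, - p.2) | p <- S g] ++
        [seq (CXZ_act act g p.1, r g (- p.2)) | p <- S h] ++ [:: (one, - c g h)])
        B p.1 p.2
      = \sum_(p <- S (g * h)%g) B p.1 p.2 + (\sum_(p <- S g) B p.1 (- p.2) +
        (\sum_(p <- S h) B (CXZ_act act g p.1) (r g (- p.2)) + B one (- c g h))).
    by rewrite 3!big_cat 2!big_map big_seq1.
  have rel : \sum_(p <- S (g * h)%g) T p.1 p.2 +
      (\sum_(p <- S g) T p.1 (- p.2) +
       (\sum_(p <- S h) T (CXZ_act act g p.1) (r g (- p.2)) +
        T one (- c g h))) = 0.
    rewrite -sumE; apply: tensor_relation => // x.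
    rewrite (sumE _ (fun d n => n *~ (d x : int))) mulr1z -SE bM.
    have -> : \sum_(p <- S g) (- p.2) *~ (p.1 x : int) = - b g x.
      by rewrite SE -sumrN; apply: eq_bigr => p _; rewrite mulNrz.
    have -> : \sum_(p <- S h) r g (- p.2) *~ (CXZ_act act g p.1 x : int)
        = - r g (b h (act g^-1%g x)).
      rewrite SE gact_sum -sumrN; apply: eq_bigr => p _.
      by rewrite gactMz rN mulNrz.
    by rewrite -!opprD addrA subrr.
  have betaN : \sum_(p <- S g) T p.1 (- p.2) = - beta g.
    by rewrite -sumrN; apply: eq_bigr => p _; rewrite TN.
  have tbetaN : \sum_(p <- S h) T (CXZ_act act g p.1) (r g (- p.2))
      = - tw_gaction I r g (beta h).
    rewrite gact_sum -sumrN; apply: eq_bigr => p _.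
    by rewrite rN TN TG.
  move: rel; rewrite T1 // addr0 betaN tbetaN -opprD => /eqP.
  by rewrite subr_eq0 => /eqP.
have [|m mE] := group_cocycle_coboundary (F := F) betaM.
  exact: tw_cohomology1_zero.
exists (fun g => \sum_(p <- S g) p.2 *~ tau p.1), (psi m); split=> // g x.
have [f fE] := additive_exists (psiD x).
rewrite -psiG -!fE -raddfB.
have -> : m - tw_gaction I r g m = beta g by rewrite mE.
rewrite SE /beta raddf_sum -big_split; apply: eq_bigr => p _ /=.
by rewrite fE psiT addrC subrK.
Qed.

(** * Solvable groups *)

Section Subgroups.
Variable H : groupType.
Implicit Types D : set H.

Lemma subgroupV D x : is_subgroup D -> D x -> D x^-1%g.
Proof. by move=> [D1 DB] Dx; rewrite -[_^-1%g]mul1g; apply: DB. Qed.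

Lemma subgroupM D x y : is_subgroup D -> D x -> D y -> D (x * y)%g.
Proof.
by move=> sD Dx Dy; rewrite -[y]invgK; apply: sD.2 => //; apply: subgroupV.
Qed.

Let gsimp := (@invgM H, @invgK H, @invg1 H, @mulgA H, @mulgK H, @mulgVK H,
  @mulgV H, @mulVg H, @mul1g H, @mulg1 H).

Lemma derived_series_subgroup n : is_subgroup (derived_series (H := H) n).
Proof.
case: n => [//|n]; split=> [A /= [[A1 _] _] //|x y Dx Dy A /= [sA cA]].
by apply: sA.2; [apply: Dx|apply: Dy].
Qed.

Lemma derived_series_normal n g (x : H) :
  derived_series n x -> derived_series n (g * x * g^-1)%g.
Proof.
elim: n g x => [//|n IHn] g x Dx A /= [sA cA].
apply: (Dx [set z | A (g * z * g^-1)%g]); split.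
  split=> [|y z Ay Az]; rewrite /= ?gsimp; first exact: sA.1.
  by have := sA.2 _ _ Ay Az; rewrite !gsimp.
move=> _ [y [z [Dy Dz ->]]] /=; apply: cA.
exists (g * y * g^-1)%g, (g * z * g^-1)%g; split; [exact: IHn|exact: IHn|].
by rewrite /commg /conjg !gsimp.
Qed.

Lemma derived_series_comm n (x y : H) :
  derived_series n x -> derived_series n y -> derived_series n.+1 [~ x, y]%g.
Proof. by move=> Dx Dy A /= [_]; apply; exists x, y. Qed.

Lemma derived_series_sub n : derived_series (H := H) n.+1 `<=` derived_series n.
Proof.
move=> x /(_ (derived_series n)); apply; split.
  exact: derived_series_subgroup.
move=> _ [y [z [Dy Dz ->]]]; have sD := derived_series_subgroup n.
rewrite /commg /conjg; apply: subgroupM => //; first exact: subgroupV.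
by apply: subgroupM => //; [exact: subgroupV|exact: subgroupM].
Qed.

(** The quotient [D / D'] is carried by canonical coset representatives in [D]. Outside [D] the map
    [pi] takes a default value, so its laws carry membership hypotheses. *)
Lemma abelian_section D D' :
    is_subgroup D -> is_subgroup D' -> D' `<=` D ->
    (forall x y, D x -> D y -> D' [~ x, y]%g) ->
  exists (N : zmodType) (pi : H -> N) (lift : N -> H),
    [/\ forall n, D (lift n), forall n, pi (lift n) = n,
        forall x y, D x -> D y -> pi (x * y)%g = pi x + pi y &
        forall x, D x -> pi x = 0 <-> D' x].
Proof.
move=> sD sD' D'D comD'.
have normD' g x : D g -> D' x -> D' (g * x * g^-1)%g.
  move=> Dg D'x; have -> : (g * x * g^-1 = x * [~ x, g^-1])%g.
    by rewrite /commg /conjg !gsimp.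
  by apply: subgroupM => //; apply: comD'; [exact: D'D|exact: subgroupV].
pose coset x : pred H := fun y => `[< D' (y * x^-1)%g >].
have coset_refl x : coset x x by apply/asboolP; rewrite mulgV; apply: sD'.1.
pose canon x := choose (coset x) x.
have canonP x : D' (canon x * x^-1)%g by exact/asboolP/(chooseP (coset_refl x)).
have canon_eq x y : D' (x * y^-1)%g -> canon x = canon y.
  move=> D'xy; have xy : coset x =1 coset y.
    move=> z; apply/asboolP/asboolP => D'z.
      by have := subgroupM sD' D'z D'xy; rewrite !gsimp.
    by have := sD'.2 _ _ D'z D'xy; rewrite !gsimp.
  rewrite /canon (eq_choose xy); apply: choose_id => //.
  by rewrite -xy.
have canonD x : D x -> D (canon x).
  by move=> Dx; have := subgroupM sD (D'D _ (canonP x)) Dx; rewrite mulgVK.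
have canonK x : canon (canon x) = canon x by apply: canon_eq; exact: canonP.
pose T : choiceType := {x : H | `[< D x >] && (canon x == x)}.
have canonT x : D x -> `[< D (canon x) >] && (canon (canon x) == canon x).
  by move=> /canonD Dx; rewrite canonK eqxx andbT; apply/asboolP.
pose one : T := exist _ (canon 1%g) (canonT _ sD.1).
pose pi x : T := insubd one (canon x).
have piE x : D x -> val (pi x) = canon x.
  by move=> /canonT Tx; rewrite /pi insubdK.
have valD (u : T) : D (val u) by case/andP: (valP u) => /asboolP.
have valK (u : T) : pi (val u) = u.
  by apply: val_inj; rewrite piE //; case/andP: (valP u) => _ /eqP.
have pi_eq x y : D' (x * y^-1)%g -> pi x = pi y.
  by move=> /canon_eq; rewrite /pi => ->.
have pi_val x : D x -> D' (val (pi x) * x^-1)%g by move=> Dx; rewrite piE.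
pose add (u v : T) := pi (val u * val v)%g.
have piM x y : D x -> D y -> pi (x * y)%g = add (pi x) (pi y).
  move=> Dx Dy; apply/esym/pi_eq.
  have := subgroupM sD' (normD' _ _ (valD (pi x)) (pi_val _ Dy)) (pi_val _ Dx).
  by rewrite !gsimp.
pose opp (u : T) := pi (val u)^-1%g.
have addA : associative add.
  move=> u v w; rewrite -[u]valK -[v]valK -[w]valK -!piM ?mulgA //;
    exact: subgroupM.
have addC : commutative add.
  move=> u v; apply: pi_eq; have := comD' _ _ (subgroupV sD (valD u))
    (subgroupV sD (valD v)).
  by rewrite /commg /conjg !gsimp.
have add0 : left_id (pi 1%g) add.
  by move=> u; rewrite -[u]valK -piM ?mul1g //; exact: sD.1.
have addN : left_inverse (pi 1%g) opp add.
  by move=> u; rewrite -{2}[u]valK /opp -piM ?mulVg //; exact: subgroupV.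
pose m := GRing.isZmodule.Build T addA addC add0 addN.
pose N : zmodType := HB.pack T m.
exists N, pi, val; split=> // x Dx; split=> [pix0|D'x]; last first.
  by apply: pi_eq; rewrite invg1 mulg1.
have := subgroupM sD' (subgroupV sD' (pi_val _ Dx)) (pi_val _ sD.1).
by rewrite (_ : pi x = pi 1%g) // !gsimp.
Qed.

End Subgroups.

(** * Descent along the derived series *)

Section SolvableRigidity.
Variables (G : groupType) (X : topologicalType) (act : dynamical_system G X).
Hypothesis Xc : compact [set: X].
Hypothesis act_ap : almost_ZG_projective act.
Variable F : projective_resolution G.
Hypothesis ftF : finite_type F.
Hypothesis H1 : cohomology_zero F (regular_module G) 1.
Hypothesis H2 : cohomology_torsion_free F (regular_module G) 2.
Variable H : groupType.

Let gsimp := (@invgM H, @invgK H, @invg1 H, @mulgA H, @mulgK H, @mulgVK H,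
  @mulgV H, @mulVg H, @mul1g H, @mulg1 H).

(* A cocycle [a] enters through [A g x = a (g, g^-1 x)]. *)
Lemma rigid_step (n : nat) (A : G -> X -> H) (s : G -> H) (x0 : X) :
    (forall g, locally_constant (A g)) ->
    (forall g h x, A (g * h)%g x = (A g x * A h (act g^-1 x))%g) ->
    (forall g x, derived_series n (A g x * (s g)^-1)%g) ->
  exists (s' : G -> H) (u : X -> H), locally_constant u /\
    forall g x, derived_series n.+1
      ((u x)^-1 * A g x * u (act g^-1 x) * (s' g)^-1)%g.
Proof.
move=> Al AM As; pose D := derived_series (H := H) n.
have sD : is_subgroup D := derived_series_subgroup H n.
have normD g x : D x -> D (g * x * g^-1)%g by exact: derived_series_normal.
have [N [pi [lift [liftD liftK piM pi0]]]] := abelian_section sD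
  (derived_series_subgroup H n.+1) (@derived_series_sub H n)
  (@derived_series_comm H n).
have pi1 : pi 1%g = 0.
  by apply/pi0; [exact: sD.1|exact: (derived_series_subgroup _ _).1].
have piV x : D x -> pi x^-1%g = - pi x.
  move=> Dx; apply: (addrI (pi x)).
  by rewrite -piM ?mulgV ?subrr //; exact: subgroupV.
have piJ g x y : D x -> D y -> pi x = pi y ->
    pi (g * x * g^-1)%g = pi (g * y * g^-1)%g.
  move=> Dx Dy xy; have Dxy : D (x * y^-1)%g by exact: sD.2.
  have : derived_series n.+1 (x * y^-1)%g.
    by apply/pi0 => //; rewrite piM ?piV ?xy ?subrr //; exact: subgroupV.
  move=> /(derived_series_normal g) /pi0 -/(_ (normD g _ Dxy)) pi_eq.
  have Dgx := normD g _ Dx; have Dgy := normD g _ Dy.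
  apply/eqP; rewrite -subr_eq0 -piV // -piM //; last exact: subgroupV.
  by move: pi_eq; rewrite !gsimp => ->.
have piJD d z : D d -> D z -> pi (d * z * d^-1)%g = pi z.
  move=> Dd Dz; have Dd' := subgroupV sD Dd; have Ddz := subgroupM sD Dd Dz.
  by rewrite !piM // piV // addrAC subrr add0r.
(* By [AM] at [x0], as [A] agrees with [s] modulo the normal subgroup [D], the map [s] is
   multiplicative modulo [D]. *)
have Dc g h : D (s g * s h * (s (g * h)%g)^-1)%g.
  have Dq := normD (A g x0) _ (subgroupV sD (As h (act g^-1%g x0))).
  have := subgroupM sD (subgroupM sD (subgroupV sD (As g x0)) Dq)
    (As (g * h)%g x0).
  by rewrite AM !gsimp.
(* Conjugation by [s g] gives an action of [G] on [N], although [s] is multiplicative only modulo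
   [D], since [D] acts trivially by conjugation ([piJD]). *)
pose r_fun g n := pi (s g * lift n * (s g)^-1)%g.
have r_pi g y : D y -> r_fun g (pi y) = pi (s g * y * (s g)^-1)%g.
  by move=> Dy; apply: piJ => //; rewrite liftK.
have rD g : {morph r_fun g : u v / u + v}.
  move=> u v; rewrite -[u]liftK -[v]liftK -piM // !r_pi //;
    last exact: subgroupM.
  by rewrite -piM; [rewrite !gsimp|exact: normD|exact: normD].
have r1 u : r_fun 1%g u = u.
  have D1 : D (s 1%g).
    have A1 : A 1%g x0 = 1%g.
      apply: (mulgI (A 1%g x0)); rewrite mulg1.
      by have := AM 1%g 1%g x0; rewrite invg1 dact1 mulg1.
    by have := As 1%g x0; rewrite A1 mul1g => /(subgroupV sD); rewrite invgK.
  by rewrite -[u in RHS]liftK; exact: piJD.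
have rM g h u : r_fun (g * h)%g u = r_fun g (r_fun h u).
  rewrite [r_fun h u]/r_fun r_pi; last exact: normD.
  have Dz := normD (s g) _ (normD (s h) _ (liftD u)).
  rewrite -(piJD _ _ (subgroupV sD (Dc g h)) Dz).
  by rewrite /r_fun !gsimp.
pose r : gaction G N := GAction rD r1 rM.
pose b g x := pi (A g x * (s g)^-1)%g.
have bl g : locally_constant (b g).
  exact: (locally_constant_comp (fun y => pi (y * (s g)^-1)%g) (Al g)).
(* The last term is the failure of [s] to be multiplicative; it does not depend on [x], as
   [abelian_rigidity] requires. *)
have bM g h x : b (g * h)%g x = b g x + r g (b h (act g^-1%g x))
    + pi (s g * s h * (s (g * h)%g)^-1)%g.
  have Dh := normD (s g) _ (As h (act g^-1%g x)).
  rewrite /= r_pi // -!piM //; last exact: subgroupM.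
  by rewrite /b AM !gsimp.
have [t [v [vl bE]]] := abelian_rigidity Xc act_ap ftF H1 H2 bl bM.
exists (fun g => lift (t g) * s g)%g, (fun x => lift (v x)); split.
  exact: (locally_constant_comp lift vl).
move=> g x; have Dv := normD (s g) _ (liftD (v (act g^-1%g x))).
have Dt := subgroupV sD (liftD (t g)); have Dvx := subgroupV sD (liftD (v x)).
have D1 := subgroupM sD Dvx (As g x); have D2 := subgroupM sD D1 Dv.
have D3 := subgroupM sD D2 Dt.
(* The product is grouped into four factors in [D], whose images [- v x], [b g x],
   [r g (v (g^-1 x))] and [- t g] cancel by [bE]. *)
have : derived_series n.+1 (((lift (v x))^-1 * (A g x * (s g)^-1)) *
    (s g * lift (v (act g^-1 x)) * (s g)^-1) * (lift (t g))^-1)%g.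
  apply/pi0 => //.
  rewrite (piM _ _ D2 Dt) (piM _ _ D1 Dv) (piM _ _ Dvx (As g x)) !piV //.
  rewrite -r_pi // !liftK.
  rewrite -[pi (A g x * _)%g]/(b g x) bE.
  rewrite -[r_fun _ _]/(r g _).
  move: (r g _) (t g) (v x) => p q w.
  by rewrite addrCA addKr subrK subrr.
by rewrite !gsimp.
Qed.

(** By induction, [rigid_step] is applied to the cocycle already transformed by [u], so the
    corrections multiply. *)
Lemma rigid_mod_derived (n : nat) (A : G -> X -> H) (x0 : X) :
    (forall g, locally_constant (A g)) ->
    (forall g h x, A (g * h)%g x = (A g x * A h (act g^-1 x))%g) ->
  exists (s : G -> H) (u : X -> H), locally_constant u /\
    forall g x, derived_series n
      ((u x)^-1 * A g x * u (act g^-1 x) * (s g)^-1)%g.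
Proof.
move=> Al AM; elim: n => [|n [s [u [ul us]]]].
  exists (fun _ => 1%g), (fun _ => 1%g); split=> // x; exact: nearW.
have ugl g : locally_constant (fun x => u (act g^-1%g x)).
  exact: locally_constant_precomp ul (@dact_continuous _ _ act _).
have [||s' [v [vl vs]]] := @rigid_step n
    (fun g x => (u x)^-1 * A g x * u (act g^-1 x))%g s x0 _ _ us.
- move=> g; have uA := locally_constant2 (fun y z => y^-1 * z)%g ul (Al g).
  exact: (locally_constant2 (fun y z => y * z)%g uA (ugl g)).
- by move=> g h x; rewrite AM invgM dactM !gsimp.
exists s', (fun x => u x * v x)%g; split.
  exact: (locally_constant2 (fun y z => y * z)%g ul vl).
by move=> g x; have := vs g x; rewrite !gsimp.
Qed.

End SolvableRigidity.

(* Rigidity of cocycles with values in a solvable group *)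
Local Close Scope ring_scope.

Theorem theorem1p7
  (G : groupType) (X : topologicalType) (act : dynamical_system G X) (n : nat)
  (G_countable : countable [set: G])
  (G_duality : duality_group G)
  (G_cd : has_cd G n) (n_neq1 : n <> 1)
  (X_compact : compact [set: X]) (X_hausdorff : hausdorff_space X)
  (act_almost_projective : almost_ZG_projective act)
  (H : groupType) (H_countable : countable [set: H])
  (H_solvable : solvable_group H) :
  continuous_cocycle_rigid H act.
Proof.
move=> a [a_cont aM].
have hom_exists (s : G -> H) : {morph s : g h / (g * h)%g} ->
    exists rho : {multiplicative G -> H}, rho =1 s.
  move=> sM; pose m := monoid.isMultiplicative.Build G H s sM.
  by exists (HB.pack_for {multiplicative G -> H} s m).
(* On an empty space the trivial homomorphism serves; otherwise [x0] is a point at which to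
   evaluate. *)
have [[x0 _]|X0] := pselect (exists x : X, True); last first.
  have [|rho _] := hom_exists (fun _ => 1%g); first by move=> g h; rewrite mulg1.
  exists rho, (fun _ => 1%g); split=> [x|g x]; first exact: cst_continuous.
  by case: X0; exists x.
have [F [ftF [m [H0 Hm]]]] := G_duality.
have H1 : cohomology_zero F (regular_module G) 1.
  exact: duality_cohomology1 G_cd n_neq1 ftF H0.
(* In the dualizing degree this is part of the duality hypothesis; otherwise the cohomology of
   degree 2 vanishes altogether. *)
have H2 : cohomology_torsion_free F (regular_module G) 2.
  have [<- //|m2] := eqVneq m 2%N => f k cf _ _.
  by apply: H0; rewrite // eq_sym.
pose A g x := a (g, act g^-1%g x).
have Al g : locally_constant (A g).
  apply: (@locally_constant_precomp _ _ _ (fun x => a (g, x)) (act g^-1%g)).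
    move=> x.
    have := a_cont (g, x) _ (discrete_set1 (a (g, x) : discrete_topology H)).
    move=> [[U V] /= [Ug Vx] UV]; apply: filterS Vx => y Vy.
    by apply: (UV (g, y)); split=> //; apply: nbhs_singleton.
  exact: dact_continuous.
have AM g h x : A (g * h)%g x = (A g x * A h (act g^-1%g x))%g.
  by rewrite /A aM invgM !dactM -dactM mulgV dact1.
have [k Hk] := H_solvable.
have [s [u [ul us]]] := rigid_mod_derived X_compact act_almost_projective ftF H1
  H2 k x0 Al AM.
have AE g x : A g x = (u x * s g * (u (act g^-1%g x))^-1)%g.
  have := us g x; rewrite Hk /= => /(congr1 (fun z => u x * z * s g)%g).
  by rewrite !mulgA mulgV mul1g mulg1 mulgVK => <-; rewrite mulgK.
(* The factors [u] cancel from the cocycle identity at [x0], which leaves the multiplicativity of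
   [s]. *)
have [|rho rhoE] := hom_exists s.
  move=> g h; have := AM g h x0.
  rewrite !AE invgM dactM !mulgA mulgVK => /mulIg.
  by rewrite -mulgA => /mulgI.
exists rho, u; split.
  exact/discrete_continuousP.
move=> g x; have := AE g (act g x).
by rewrite /A -dactM mulVg dact1 rhoE.
Qed.
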